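(* Let $\sigma\in\mathcal{P}_c^+$, let $t>0$ be a real number, and let $\nu:=\Psi(\sigma^{\uplus t},\sigma)$. Let $\tau_1,\tau_2\in\mathcal{P}_c^+$ be the distributions of $ZZ^*$ and of $Z^*Z$, respectively, in the noncommutative probability space $(\mathbb{C}\langle Z,Z^*\rangle,\nu)$. Then $$\tau_1=\bigl(\mathbb{B}(\sigma)\boxtimes\Pi_1\bigr)^{\boxplus t}\qquad\text{and}\qquad\tau_2=\bigl(\mathbb{B}(\sigma)^{\boxplus t}\boxtimes\Pi_1\bigr)^{\boxplus 1/t}.$$
   Context: $\mathcal{P}_c$ (resp. $\mathcal{P}_c^+$) is the set of compactly supported Borel probability measures on $\mathbb{R}$ (resp. on $[0,\infty)$). For $\sigma\in\mathcal{P}_c$: $M_\sigma(z)=\sum_{n\ge1}\bigl(\int t^n\,d\sigma(t)\bigr)z^n$, $\eta_\sigma=M_\sigma/(1+M_\sigma)$, and $R_\sigma$ is the unique formal power series with zero constant term with $R_\sigma(z(1+M_\sigma(z)))=M_\sigma(z)$. $\mathbb{B}(\sigma)\in\mathcal{P}_c$ is the unique measure with $R_{\mathbb{B}(\sigma)}=\eta_\sigma$ (exists; it lies in $\mathcal{P}_c^+$ if $\sigma\in\mathcal{P}_c^+$). For $t>0$, $\sigma^{\uplus t}$ is the unique measure in $\mathcal{P}_c$ with $\eta_{\sigma^{\uplus t}}=t\,\eta_\sigma$ (exists for all $t>0$; lies in $\mathcal{P}_c^+$ if $\sigma\in\mathcal{P}_c^+$). $\sigma^{\boxplus t}$ is the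 unique measure in $\mathcal{P}_c$ with $R_{\sigma^{\boxplus t}}=t\,R_\sigma$ (it exists for all $t\ge1$, and for all $t>0$ when $\sigma$ is infinitely divisible with respect to free additive convolution). $\boxtimes$ is free multiplicative convolution on $\mathcal{P}_c^+$: $\sigma\boxtimes\sigma'$ is the measure with moments $\varphi((ab)^n)$ where $a,b$ are free positive elements of a $C^*$-probability space with distributions $\sigma,\sigma'$. $\Pi_1$ is the Marchenko–Pastur (free Poisson) distribution, with density $\frac{1}{2\pi}\sqrt{(4-t)/t}$ on $[0,4]$ and $R_{\Pi_1}(z)=z/(1-z)$. $*$-distributions: $\mathbb{C}\langle Z,Z^*\rangle$ is the algebra of complex polynomials in two non-commuting variables; $\mathcal{W}^+=\bigsqcup_{n\ge1}\{1,*\}^n$; for $w=(\ell_1,\dots,\ell_n)$ let $|w|=n$, $Z^w=Z^{\ell_1}\cdots Z^{\ell_n}$, and likewise $a^w$, $z^w$ (with $z,z^*$ non-commuting formal indeterminates). The $*$-distribution of an element $a$ of a $C^*$-probability space $(\mathcal{A},\varphi)$ (unital $C^*$-algebra with positive linear $\varphi$, $\varphi(1)=1$, not assumed tracial) is the linear functional $\mu$ on $\mathbb{C}\langle Z,Z^*\rangle$ with $\mu(1)=1$, $\mu(Z^w)=\varphi(a^w)$; $\mathcal{D}_c(1,* )$ is the set of all of these. For $\mu\in\mathcal{D}_c(1,* )$: $M_\mu=\sum_{w}\mu(Z^w)z^w$; $\eta_\mu=M_\mu(1+M_\mu)^{-1}$; $R_\mu$ is the unique formal series with zero constant term such that for $|w|=n$,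 $\mu(Z^w)=\sum_{\pi\in NC(n)}\prod_{B\in\pi}\mathrm{Cf}_{w|B}(R_\mu)$, where $NC(n)$ is the set of non-crossing partitions of $\{1,\dots,n\}$, $\mathrm{Cf}_v$ is the coefficient of $z^v$, and $w|B$ is the subword of $w$ with positions in $B$. $\mu$ is $\eta$-diagonal if $\mathrm{Cf}_w(\eta_\mu)=0$ for all $w$ not of the form $(1,* )^m$ or $( *,1)^m$, $m\ge1$. The distributions of $ZZ^*$ and $Z^*Z$ in $(\mathbb{C}\langle Z,Z^*\rangle,\mu)$ are the unique measures in $\mathcal{P}_c^+$ with moments $\mu((ZZ^* )^n)$ and $\mu((Z^*Z)^n)$, $n\in\mathbb{N}$. Definition of $\Psi$: for $\sigma_1,\sigma_2\in\mathcal{P}_c^+$ there is a unique $\eta$-diagonal $\mu\in\mathcal{D}_c(1,* )$ such that the distributions of $ZZ^*$ and $Z^*Z$ in $(\mathbb{C}\langle Z,Z^*\rangle,\mu)$ are $\sigma_1$ and $\sigma_2$; $\Psi(\sigma_1,\sigma_2)$ is the unique $\nu\in\mathcal{D}_c(1,* )$ with $R_\nu=\eta_\mu$ (it exists). *)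

(* Defs.v *)
From HB Require Import structures.
From mathcomp Require Import all_boot all_order all_algebra complex.
From mathcomp Require Import all_classical all_reals all_analysis.

Set Implicit Arguments.
Unset Strict Implicit.
Unset Printing Implicit Defensive.

Import Order.TTheory GRing.Theory Num.Theory numFieldNormedType.Exports.

Local Open Scope ring_scope.
Local Open Scope complex_scope.
Local Open Scope classical_set_scope.

(* A triangular system of equations x w = F x w, in which F x w only looks at
   the values of x at arguments smaller than w, has exactly one solution.  All
   the formal series below are solutions of such systems. *)
Lemma triangular_system (T K : Type) (k0 : K) (sz : T -> nat)
    (F : (T -> K) -> T -> K) :
  (forall x y w, (forall v, (sz v < sz w)%N -> x v = y v) -> F x w = F y w) ->
  exists! x : T -> K, forall w, x w = F x w.
Proof.
move=> FP; pose it n := iter n F (fun=> k0).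
have itE n m w : (sz w < n)%N -> (sz w < m)%N -> it n w = it m w.
  elim: n m w => // n IHn [//|m] w; rewrite !ltnS /it /= => wn wm.
  by apply: FP => v vw; apply: IHn; apply: leq_trans vw _.
exists (fun w => it (sz w).+1 w); split.
  by move=> w; rewrite {1}/it /=; apply: FP => v vw;
    exact: (itE _ _ _ vw (ltnSn _)).
move=> y yE; apply/funext => w.
have [n] := ubnP (sz w); elim: n w => // n IHn w; rewrite ltnS => wn.
rewrite yE /it /=; apply: FP => v vw.
rewrite -IHn; last exact: leq_trans vw wn.
exact: (itE _ _ _ vw (ltnSn _)).
Qed.

Definition ser_one (K : nzRingType) (n : nat) : K := (n == 0)%:R.

Definition ser_add (K : nzRingType) (f g : nat -> K) (n : nat) : K := f n + g n.

Definition ser_scale (K : nzRingType) (c : K) (f : nat -> K) (n : nat) : K :=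
  c * f n.

Definition ser_mul (K : nzRingType) (f g : nat -> K) (n : nat) : K :=
  \sum_(i < n.+1) f i * g (n - i)%N.

Definition ser_exp (K : nzRingType) (f : nat -> K) (k : nat) : nat -> K :=
  iter k (ser_mul f) (@ser_one K).

Definition ser_mulX (K : nzRingType) (f : nat -> K) (n : nat) : K :=
  if n is k.+1 then f k else 0.

(* The composition f(g(z)); it is meaningful only when g 0 = 0, and the terms
   with k > n then do not contribute to the coefficient of z^n. *)
Definition ser_comp (K : nzRingType) (f g : nat -> K) (n : nat) : K :=
  \sum_(k < n.+1) f k * ser_exp g k n.


Definition Mser (K : nzRingType) (m : nat -> K) (n : nat) : K :=
  if n == 0 then 0 else m n.

Definition is_eta_ser (K : nzRingType) (m e : nat -> K) : Prop :=
  ser_mul e (ser_add (@ser_one K) (Mser m)) = Mser m.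

Definition is_R_ser (K : nzRingType) (m r : nat -> K) : Prop :=
  r 0 = 0 /\
  ser_comp r (ser_mulX (ser_add (@ser_one K) (Mser m))) = Mser m.

Lemma eta_ser_ex (K : nzRingType) (m : nat -> K) :
  exists! e, is_eta_ser m e.
Proof.
pose F (e : nat -> K) n :=
  Mser m n - \sum_(i < n) e i * ser_add (@ser_one K) (Mser m) (n - i)%N.
have FE e : is_eta_ser m e <-> forall n, e n = F e n.
  have mulE n : ser_mul e (ser_add (@ser_one K) (Mser m)) n =
      \sum_(i < n) e i * ser_add (@ser_one K) (Mser m) (n - i)%N + e n.
    by rewrite /ser_mul big_ord_recr /= subnn /ser_add /ser_one /Mser /=
               addr0 mulr1.
  split=> [eE n|eE]; last first.
    by apply/funext => n; rewrite mulE [X in _ + X]eE addrC subrK.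
  by rewrite /F; have /= := congr1 (@^~ n) eE; rewrite mulE => <-;
     rewrite addrAC subrr add0r.
have [|e [eP eU]] := @triangular_system nat K 0 id F.
  move=> x y n xy; congr (_ - _); apply: eq_bigr => i _; congr (_ * _).
  exact/xy/ltn_ord.
by exists e; split=> [|e' /FE /eU //]; apply/FE.
Qed.

Lemma ser_exp_lt (K : nzRingType) (g : nat -> K) k n :
  g 0 = 0 -> (n < k)%N -> ser_exp g k n = 0.
Proof.
move=> g0; elim: k n => // k IHk n; rewrite ltnS => nk.
rewrite /ser_exp /= /ser_mul big1 // => -[[|i] /= lti] _.
  by rewrite g0 mul0r.
by rewrite -/(ser_exp g k) IHk ?mulr0 //; apply: leq_trans nk; rewrite ltn_subrL;
   case: n lti.
Qed.

Lemma ser_exp_diag (K : nzRingType) (g : nat -> K) k :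
  g 0 = 0 -> g 1%N = 1 -> ser_exp g k k = 1.
Proof.
move=> g0 g1; elim: k => // k IHk; rewrite /ser_exp /= /ser_mul.
rewrite big_ord_recl big_ord_recl /= g0 mul0r add0r g1 mul1r subSS subn0.
rewrite -/(ser_exp g k) IHk big1 ?addr0 // => i _.
rewrite ser_exp_lt ?mulr0 // /bump /= !add1n subSS.
by rewrite ltn_subrL (leq_ltn_trans _ (ltn_ord i)).
Qed.

Lemma R_ser_ex (K : nzRingType) (m : nat -> K) : exists! r, is_R_ser m r.
Proof.
pose g := ser_mulX (ser_add (@ser_one K) (Mser m)).
have g0 : g 0 = 0 by [].
have g1 : g 1%N = 1 by rewrite /g /= /ser_add /ser_one /Mser /= addr0.
pose F (r : nat -> K) n := Mser m n - \sum_(k < n) r k * ser_exp g k n.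
have FE r : is_R_ser m r <-> forall n, r n = F r n.
  have compE n : ser_comp r g n = \sum_(k < n) r k * ser_exp g k n + r n.
    by rewrite /ser_comp big_ord_recr /= ser_exp_diag // mulr1.
  split=> [[r0 rE] n|rE].
    by rewrite /F; have /= := congr1 (@^~ n) rE; rewrite -/g compE => <-;
       rewrite addrAC subrr add0r.
  split; first by rewrite rE /F big_ord0 subr0.
  by apply/funext => n; rewrite -/g compE [X in _ + X]rE addrC subrK.
have [|r [rP rU]] := @triangular_system nat K 0 id F.
  move=> x y n xy; congr (_ - _); apply: eq_bigr => i _; congr (_ * _).
  exact/xy/ltn_ord.
by exists r; split=> [|r' /FE /rU //]; apply/FE.
Qed.

Definition eta_ser (K : nzRingType) (m : nat -> K) : nat -> K :=
  sval (cid (eta_ser_ex m)).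

Definition R_ser (K : nzRingType) (m : nat -> K) : nat -> K :=
  sval (cid (R_ser_ex m)).

Lemma eta_serP (K : nzRingType) (m : nat -> K) : is_eta_ser m (eta_ser m).
Proof. by rewrite /eta_ser; case: cid => e []. Qed.

Lemma R_serP (K : nzRingType) (m : nat -> K) : is_R_ser m (R_ser m).
Proof. by rewrite /R_ser; case: cid => r []. Qed.

Definition borel_probability (R : realType) : Type :=
  probability (measurableTypeR R) R.

Definition Pc (R : realType) (s : borel_probability R) : Prop :=
  exists K : set R, compact K /\ s (~` K) = 0%E.

Definition Pc_plus (R : realType) (s : borel_probability R) : Prop :=
  Pc s /\ s `[0, +oo[ = 1%E.

Definition moment (R : realType) (s : borel_probability R) (n : nat) : R :=
  \int[s]_x (x ^+ n).

Definition eta_transform (R : realType) (s : borel_probability R) : nat -> R :=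
  eta_ser (moment s).

Definition R_transform (R : realType) (s : borel_probability R) : nat -> R :=
  R_ser (moment s).

(* A measure in Pc is determined by its moments, hence by its eta-series and by
   its R-transform.  The convolution powers, the Boolean Bercovici-Pata
   bijection and the free multiplicative convolution are given as graphs:
   is_... s r reads "r is the image of s". *)

Definition is_Bercovici_Pata (R : realType) (s b : borel_probability R) : Prop :=
  [/\ Pc s, Pc b & R_transform b = eta_transform s].

Definition is_uplus_power (R : realType) (s : borel_probability R) (t : R)
    (r : borel_probability R) : Prop :=
  [/\ Pc s, Pc r & eta_transform r = ser_scale t (eta_transform s)].

Definition is_boxplus_power (R : realType) (s : borel_probability R) (t : R)
    (r : borel_probability R) : Prop :=
  [/\ Pc s, Pc r & R_transform r = ser_scale t (R_transform s)].

(* At the single point x = 0 the density takes the irrelevant value 0. *)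
Definition is_Marchenko_Pastur (R : realType) (p : borel_probability R) : Prop :=
  forall A : set (measurableTypeR R), measurable A ->
    p A = (\int[lebesgue_measure]_(x in A `&` `[0%R, 4%R])
             ((2 * pi)^-1 * Num.sqrt ((4 - x) / x))%:E)%E.

(* The multiplicative structure is the one of the library; a normed ring
   structure over R[i] is not available there, so that the norm and its
   completeness are part of the record. *)
Record cstar_algebra (R : realType) := CStarAlgebra {
  cstar_sort :> algType R[i];
  star : cstar_sort -> cstar_sort;
  starD : forall x y, star (x + y) = star x + star y;
  starZ : forall (c : R[i]) x, star (c *: x) = c^*%R *: star x;
  starM : forall x y, star (x * y) = star y * star x;
  starK : forall x, star (star x) = x;
  cnorm : cstar_sort -> R;
  cnorm_ge0 : forall x, 0 <= cnorm x;
  cnorm0_eq0 : forall x, cnorm x = 0 -> x = 0;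
  cnormD : forall x y, cnorm (x + y) <= cnorm x + cnorm y;
  cnormZ : forall (c : R[i]) x, (cnorm (c *: x))%:C = `|c| * (cnorm x)%:C;
  cnormM : forall x y, cnorm (x * y) <= cnorm x * cnorm y;
  cnorm_star : forall x, cnorm (star x * x) = cnorm x ^+ 2;
  cnorm_complete : forall u : nat -> cstar_sort,
    (forall e : R, 0 < e -> exists N, forall m n,
       (N <= m)%N -> (N <= n)%N -> cnorm (u m - u n) < e) ->
    exists l, forall e : R, 0 < e -> exists N, forall n,
       (N <= n)%N -> cnorm (u n - l) < e
}.

(* The order of R[i] makes "0 <= z" mean that z is real and nonnegative. *)
Definition is_state (R : realType) (A : cstar_algebra R) (phi : {scalar A}) :
    Prop :=
  phi 1 = 1 /\ forall x : A, 0 <= phi (star x * x).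

Definition cstar_positive (R : realType) (A : cstar_algebra R) (a : A) : Prop :=
  exists x : A, a = star x * x.

Definition has_moments (R : realType) (A : cstar_algebra R)
    (phi : {scalar A}) (a : A) (s : borel_probability R) : Prop :=
  forall n, phi (a ^+ n) = (moment s n)%:C.

Definition free_subalgebras (R : realType) (A : cstar_algebra R)
    (phi : {scalar A}) (B : bool -> set A) : Prop :=
  forall (n : nat) (i : nat -> bool) (x : nat -> A),
    (forall k, (k < n)%N -> i k != i k.+1) ->
    (forall k, (k <= n)%N -> B (i k) (x k) /\ phi (x k) = 0) ->
    phi (\prod_(0 <= k < n.+1) x k) = 0.

(* For selfadjoint elements: the unital *-algebra generated by a consists of the
   polynomials in a. *)
Definition free_selfadjoint (R : realType) (A : cstar_algebra R)
    (phi : {scalar A}) (a b : A) : Prop :=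
  free_subalgebras phi
    (fun i => range (horner_alg (if i then b else a) : {poly R[i]} -> A)).

Definition is_boxtimes (R : realType) (s s' r : borel_probability R) : Prop :=
  [/\ Pc_plus s, Pc_plus s', Pc_plus r &
   exists (A : cstar_algebra R) (phi : {scalar A}) (a b : A),
     [/\ is_state phi,
         cstar_positive a /\ has_moments phi a s,
         cstar_positive b /\ has_moments phi b s',
         free_selfadjoint phi a b &
         has_moments phi (a * b) r]].

(* A word over {1, *} is a sequence of booleans, true standing for "*".  A
   linear functional on C<Z, Z*> is given by its values on the basis of the
   monomials Z^w; a formal series is given by its coefficients. *)

Definition word : Type := seq bool.

Definition word_pow (w : word) (n : nat) : word := flatten (nseq n w).

Definition word_ZZs : word := [:: false; true].

Definition word_ZsZ : word := [:: true; false].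

Definition star_monomial (R : realType) (A : cstar_algebra R) (a : A)
    (w : word) : A :=
  \prod_(l <- w) (if l then star a else a).

Definition Dc (R : realType) (mu : word -> R[i]) : Prop :=
  exists (A : cstar_algebra R) (phi : {scalar A}) (a : A),
    is_state phi /\ forall w, mu w = phi (star_monomial a w).

Definition nser_one (K : nzRingType) (w : word) : K := (w == [::])%:R.

Definition nser_add (K : nzRingType) (f g : word -> K) (w : word) : K :=
  f w + g w.

Definition nser_mul (K : nzRingType) (f g : word -> K) (w : word) : K :=
  \sum_(i < (size w).+1) f (take i w) * g (drop i w).

Definition Mnser (K : nzRingType) (m : word -> K) (w : word) : K :=
  if w is [::] then 0 else m w.

(* eta = M (1 + M)^-1, i.e. eta (1 + M) = M *)
Definition is_eta_nser (K : nzRingType) (m e : word -> K) : Prop :=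
  nser_mul e (nser_add (@nser_one K) (Mnser m)) = Mnser m.

Definition noncrossing (n : nat) (P : {set {set 'I_n}}) : bool :=
  [forall V in P, forall W in P, (V != W) ==>
    [forall a in V, forall b in W, forall c in V, forall d in W,
       ~~ [&& a < b, b < c & c < d]%N]].

Definition NC (n : nat) : {set {set {set 'I_n}}} :=
  [set P : {set {set 'I_n}} | finset.partition P [set: 'I_n] & noncrossing P]%SET.

(* enum B lists the positions in B in increasing order. *)
Definition subword (w : word) (B : {set 'I_(size w)}) : word :=
  [seq tnth (in_tuple w) i | i <- enum B].

Definition is_R_nser (K : comNzRingType) (m r : word -> K) : Prop :=
  r [::] = 0 /\
  forall w, w <> [::] ->
    m w = \sum_(P in NC (size w)) \prod_(B in P) r (subword B).

Lemma eta_nser_ex (K : nzRingType) (m : word -> K) :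
  exists! e, is_eta_nser m e.
Proof.
pose G (e : word -> K) w :=
  \sum_(i < size w) e (take i w) * nser_add (@nser_one K) (Mnser m) (drop i w).
pose F (e : word -> K) w := Mnser m w - G e w.
have FE e : is_eta_nser m e <-> forall w, e w = F e w.
  have mulE w : nser_mul e (nser_add (@nser_one K) (Mnser m)) w = G e w + e w.
    by rewrite /nser_mul big_ord_recr /= take_size drop_size /nser_add /nser_one
               /Mnser /= addr0 mulr1.
  split=> [eE w|eE]; last first.
    by apply/funext => w; rewrite mulE [X in _ + X]eE addrC subrK.
  by rewrite /F; have /= := congr1 (@^~ w) eE; rewrite mulE => <-;
     rewrite addrAC subrr add0r.
have [|e [eP eU]] := @triangular_system word K 0 size F.
  move=> x y w xy; congr (_ - _); apply: eq_bigr => i _; congr (_ * _).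
  by apply: xy; rewrite size_take ltn_ord.
by exists e; split=> [|e' /FE /eU //]; apply/FE.
Qed.

Lemma trivial_partition (n : nat) (P : {set {set 'I_n.+1}}) :
  finset.partition P [set: 'I_n.+1]%SET -> [set: 'I_n.+1]%SET \in P ->
  P = [set [set: 'I_n.+1]]%SET.
Proof.
case/and3P => _ /finset.trivIsetP tP P0 TP; apply/setP => B; rewrite inE.
apply/idP/eqP => [BP|-> //]; apply/eqP; apply: contraT => BT.
have := tP _ _ BP TP BT; rewrite -finset.setI_eq0 finset.setIT => /eqP B0.
by rewrite -B0 BP in P0.
Qed.

Lemma subword_setT (w : word) : subword [set: 'I_(size w)]%SET = w.
Proof.
rewrite /subword; transitivity [seq tnth (in_tuple w) i | i <- enum 'I_(size w)].
  by congr map; apply: eq_enum => i; rewrite inE.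
exact: (map_tnth_enum (in_tuple w)).
Qed.

Lemma one_block_NC (n : nat) : [set [set: 'I_n.+1]]%SET \in NC n.+1.
Proof.
rewrite inE; apply/andP; split.
  apply/and3P; split.
  - by rewrite /finset.cover finset.big_set1.
  - by apply/finset.trivIsetP => A B /set1P -> /set1P ->; rewrite eqxx.
  - by rewrite inE; apply/eqP => /setP/(_ ord0); rewrite !inE.
apply/forall_inP => V /set1P ->; apply/forall_inP => W /set1P ->.
by rewrite eqxx.
Qed.

Lemma R_nser_ex (K : comNzRingType) (m : word -> K) :
  exists! r, is_R_nser m r.
Proof.
pose G (r : word -> K) w :=
  \sum_(P in NC (size w) | P != [set [set: 'I_(size w)]]%SET)
     \prod_(B in P) r (subword B).
pose F (r : word -> K) w := if w is [::] then 0 else m w - G r w.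
have FE r : is_R_nser m r <-> forall w, r w = F r w.
  have sumE w : w <> [::] ->
      \sum_(P in NC (size w)) \prod_(B in P) r (subword B) = r w + G r w.
    move=> w0; rewrite (bigD1 [set [set: 'I_(size w)]]%SET) /=; last first.
      by case: w w0 => // l w _; apply: one_block_NC.
    by rewrite finset.big_set1 subword_setT.
  split=> [[r0 rE] [//|l w]|rE]; first by rewrite /F rE // sumE // addrK.
  split; first by rewrite rE.
  by move=> w w0; rewrite sumE // {1}rE; case: w w0 => // l w _; rewrite subrK.
have [|r [rP rU]] := @triangular_system word K 0 size F.
  move=> x y [//|l w] xy; congr (_ - _); apply: eq_bigr => P /andP[PNC PT].
  apply: eq_bigr => B BP; apply: xy.
  rewrite size_map -cardE.
  rewrite -[X in (_ < X)%N]card_ord -cardsT.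
  apply: proper_card; rewrite finset.properT; apply: contraNneq PT => BT.
  move: PNC; rewrite inE => /andP[Ppart _].
  by apply/eqP/trivial_partition => //; rewrite -BT.
by exists r; split=> [|r' /FE /rU //]; apply/FE.
Qed.

Definition eta_nser (K : nzRingType) (m : word -> K) : word -> K :=
  sval (cid (eta_nser_ex m)).

Definition R_nser (K : comNzRingType) (m : word -> K) : word -> K :=
  sval (cid (R_nser_ex m)).

Lemma eta_nserP (K : nzRingType) (m : word -> K) : is_eta_nser m (eta_nser m).
Proof. by rewrite /eta_nser; case: cid => e []. Qed.

Lemma R_nserP (K : comNzRingType) (m : word -> K) : is_R_nser m (R_nser m).
Proof. by rewrite /R_nser; case: cid => r []. Qed.

Definition eta_diagonal (R : realType) (mu : word -> R[i]) : Prop :=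
  forall w : word,
    (forall n, (0 < n)%N -> w <> word_pow word_ZZs n /\ w <> word_pow word_ZsZ n) ->
    eta_nser mu w = 0.

(* s is the distribution of Z^w in (C<Z, Z*>, mu), for Z^w = ZZ* or Z*Z. *)
Definition is_distribution_word (R : realType) (mu : word -> R[i]) (w : word)
    (s : borel_probability R) : Prop :=
  Pc_plus s /\ forall n, mu (word_pow w n) = (moment s n)%:C.

Definition is_Psi (R : realType) (s1 s2 : borel_probability R)
    (nu : word -> R[i]) : Prop :=
  [/\ Dc nu, Pc_plus s1, Pc_plus s2 & exists mu : word -> R[i],
    [/\ Dc mu, eta_diagonal mu,
        is_distribution_word mu word_ZZs s1,
        is_distribution_word mu word_ZsZ s2 &
        R_nser nu = eta_nser mu]].

(* Main.v *)
(* Write e for the eta-series of sigma, and P, Q for the moment series of tau1,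
   tau2.  Since nu is R-diagonal with determining series t e and e, decomposing a
   non-crossing partition along the block of its first element gives
   P = 1 + t e(z P Q) and Q = 1 + e(z P Q).  As R_beta = e, the series
   M_beta(z P) and Q - 1 solve the same fixed point equation x = e(z P (1 + x)),
   so R_tau1 = t M_beta; likewise R_tau2 = t^-1 M_{beta_t}.  On the other side,
   R_{s boxtimes Pi_1} = M_s. *)

Require Import Defs.
From HB Require Import structures.
From mathcomp Require Import all_boot all_order all_algebra complex.
From mathcomp Require Import all_classical all_reals all_analysis.
From mathcomp Require Import measurable_realfun.
From mathcomp Require Import ring lra zify.

Set Implicit Arguments.
Unset Strict Implicit.
Unset Printing Implicit Defensive.

Import Order.TTheory GRing.Theory Num.Theory numFieldNormedType.Exports.

Local Open Scope ring_scope.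

(** * The ring of formal power series *)

(** A block with 2k letters inside an alternating word leaves 2k gaps, the last one running to the
    end of the word. Odd or non-alternating blocks have vanishing cumulant, so in a contributing
    partition all these gaps have even length and are alternately of two kinds: k contribute [P] and
    k contribute [Q]. This is the origin of the argument z P Q. Instead of summing over the shape of
    the block, the proof reads it from left to right, each new letter cutting off one gap.

    The R-transform of s boxtimes Pi_1 has to come from the bare definition of freeness: alternating
    products of centred elements have expectation zero. A factorization of 1 - z a b through
    resolvents of [a] and [b] makes such products appear. The Marchenko-Pastur law enters there only
    through the Catalan equation m = 1 + z m^2 for its moment series, which integration by parts
    extracts from the density. *)

Definition fps (K : Type) : Type := nat -> K.

Section FpsRing.
Variable K : nzRingType.

(** Addition is the pointwise one of functions, but the product will be the Cauchy product; the
    alias keeps it apart from a pointwise product. Coefficients may be non-commutative, because the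
    freeness argument uses series over an algebra. *)
HB.instance Definition _ := GRing.Zmodule.copy (fps K) (nat -> K).

Lemma fpsD (f g : fps K) n : (f + g) n = f n + g n. Proof. by []. Qed.
Lemma fpsN (f : fps K) n : (- f) n = - f n. Proof. by []. Qed.
(** Coefficient [m] of a product sees only coefficients up to [m], so truncation to polynomials
    loses nothing there; associativity is then inherited from polynomials. *)
Lemma coef_mul_trunc (f g : nat -> K) N m : (m < N)%N ->
  ((\poly_(i < N) f i) * (\poly_(i < N) g i))`_m = ser_mul f g m.
Proof.
move=> mN; rewrite coefM; apply: eq_bigr => i _.
have ltN k : (k <= m)%N -> (k < N)%N by move=> km; apply: leq_ltn_trans mN.
by rewrite !coef_poly !ltN ?leq_subr // -ltnS.
Qed.

Lemma ser_mulA : associative (@ser_mul K).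
Proof.
move=> f g h; apply/funext => n.
pose T (s : nat -> K) := \poly_(i < n.+1) s i.
transitivity ((T f * (T g * T h))`_n).
  rewrite coefM; apply: eq_bigr => i _.
  by rewrite coef_poly ltn_ord coef_mul_trunc // ltnS leq_subr.
rewrite mulrA coefM; apply: eq_bigr => i _.
by rewrite coef_mul_trunc // [_`_(_ - _)]coef_poly ltnS leq_subr.
Qed.

Lemma ser_mul1 : left_id (@ser_one K) (@ser_mul K).
Proof.
move=> f; apply/funext => n; rewrite /ser_mul big_ord_recl /= /ser_one mul1r.
by rewrite subn0 big1 ?addr0 // => i _; rewrite mul0r.
Qed.

Lemma ser_mulr1 : right_id (@ser_one K) (@ser_mul K).
Proof.
move=> f; apply/funext => n; rewrite /ser_mul big_ord_recr /= /ser_one subnn.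
by rewrite mulr1 big1 ?add0r // => i _; rewrite subn_eq0 leqNgt ltn_ord mulr0.
Qed.

Lemma ser_mulDl : left_distributive (@ser_mul K) (fun f g : fps K => f + g).
Proof.
move=> f g h; apply/funext => n; rewrite fpsD /ser_mul -big_split /=.
by apply: eq_bigr => i _; rewrite fpsD mulrDl.
Qed.

Lemma ser_mulDr : right_distributive (@ser_mul K) (fun f g : fps K => f + g).
Proof.
move=> f g h; apply/funext => n; rewrite fpsD /ser_mul -big_split /=.
by apply: eq_bigr => i _; rewrite fpsD mulrDr.
Qed.

Lemma ser_one_neq0 : (@ser_one K : fps K) != 0.
Proof.
by apply/eqP => /(congr1 (@^~ 0)) /eqP; rewrite /ser_one /= oner_eq0.
Qed.

HB.instance Definition _ := GRing.Zmodule_isNzRing.Build (fps K)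
  ser_mulA ser_mul1 ser_mulr1 ser_mulDl ser_mulDr ser_one_neq0.

Lemma fps1 n : (1 : fps K) n = (n == 0)%:R. Proof. by []. Qed.

Lemma fpsM (f g : fps K) n : (f * g) n = \sum_(i < n.+1) f i * g (n - i)%N.
Proof. by []. Qed.

Definition fpsC (c : K) : fps K := fun n => if n == 0 then c else 0.
Definition fpsX : fps K := fun n => (n == 1)%:R.

Lemma fpsCM c (f : fps K) n : (fpsC c * f) n = c * f n.
Proof.
by rewrite fpsM big_ord_recl subn0 big1 ?addr0 // => i _; rewrite mul0r.
Qed.

Lemma fpsMC c (f : fps K) n : (f * fpsC c) n = f n * c.
Proof.
rewrite fpsM big_ord_recr /= subnn big1 ?add0r // => i _.
by rewrite /fpsC subn_eq0 leqNgt ltn_ord mulr0.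
Qed.

Lemma fpsXM (f : fps K) n : (fpsX * f) n = ser_mulX f n.
Proof.
rewrite fpsM big_ord_recl mul0r add0r; case: n => [|n]; first by rewrite big_ord0.
rewrite big_ord_recl /= mul1r subn1 big1 ?addr0 // => i _.
by rewrite /fpsX mul0r.
Qed.

Lemma fpsXME (f : fps K) : fpsX * f = ser_mulX f.
Proof. by apply/funext => n; rewrite fpsXM. Qed.

Definition agree n (f g : fps K) := forall i, (i < n)%N -> f i = g i.

Lemma agreeP (f g : fps K) : (forall n, agree n f g) -> f = g.
Proof. by move=> fg; apply/funext => n; apply: (fg n.+1). Qed.

Lemma agree_trans n f g h : agree n f g -> agree n g h -> agree n f h.
Proof. by move=> fg gh i lin; rewrite fg // gh. Qed.

Lemma agreeD n f f' g g' :
  agree n f f' -> agree n g g' -> agree n (f + g) (f' + g').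
Proof. by move=> ff gg i lin; rewrite !fpsD ff ?gg. Qed.

Lemma agreeM n f f' g g' :
  agree n f f' -> agree n g g' -> agree n (f * g) (f' * g').
Proof.
move=> ff gg i lin; rewrite !fpsM; apply: eq_bigr => j _; congr (_ * _).
  by apply: ff; apply: leq_trans (ltn_ord j) lin.
by apply: gg; apply: leq_ltn_trans (leq_subr _ _) lin.
Qed.

(** As [d] is divisible by z, coefficient [n] of [d * f] involves only coefficients of [f] below
    [n]. This gain of one order drives all inductions on precision below. *)
Lemma agree_mulS n (d f g : fps K) :
  d 0%N = 0 -> agree n f g -> agree n.+1 (d * f) (d * g).
Proof.
move=> d0 fg i lin; rewrite !fpsM !big_ord_recl /= d0 !mul0r.
congr (_ + _); apply: eq_bigr => j _; congr (_ * _); apply: fg.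
rewrite /bump /= add1n; case: i lin j => [|i] lin j; first by case: j.
by rewrite subSS; apply: leq_ltn_trans (leq_subr _ _) _.
Qed.

Lemma fpsM0 (f g : fps K) : (f * g) 0%N = f 0%N * g 0%N.
Proof. by rewrite fpsM big_ord1. Qed.

Lemma fps_exp_lt (d : fps K) k n : d 0%N = 0 -> (n < k)%N -> (d ^+ k) n = 0.
Proof.
move=> d0; elim: k n => // k IH n; rewrite ltnS exprS => nk.
have /(_ n) -> : agree k.+1 (d * d ^+ k) (d * 0) by apply: agree_mulS.
  by rewrite mulr0.
by rewrite ltnS.
Qed.

Definition fps_shift (f : fps K) : fps K := fun n => f n.+1.

Lemma fps_shiftE f : f = fpsC (f 0%N) + fpsX * fps_shift f.
Proof.
apply/funext => -[|n]; rewrite fpsD fpsXM /= /fpsC /= ?addr0 // add0r.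
by [].
Qed.

Definition fps_comp (f g : fps K) : fps K := ser_comp f g.

Lemma ser_expE (g : fps K) k : ser_exp g k = (g ^+ k : fps K).
Proof. by elim: k => // k IH; rewrite exprS /ser_exp /= -/(ser_exp g k) IH. Qed.

Lemma fps_sum (I : finType) (P : pred I) (F : I -> fps K) n :
  (\sum_(i | P i) F i) n = \sum_(i | P i) F i n.
Proof. by elim/big_rec2: _ => // i x y _ <-. Qed.

Lemma fps_comp_trunc (f g : fps K) n N : g 0%N = 0 -> (n < N)%N ->
  fps_comp f g n = \sum_(k < N) f k * (g ^+ k) n.
Proof.
move=> g0 nN; rewrite /fps_comp /ser_comp.
rewrite (big_ord_widen N (fun k => f k * ser_exp g k n)) //.
rewrite big_mkcond /=; apply: eq_bigr => k _; rewrite ser_expE ltnS.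
by case: leqP => // nk; rewrite fps_exp_lt ?mulr0.
Qed.

(** Horner's rule, from f = f(0) + z h with h the shift of [f]. The inner series stays on the right,
    as its powers do in [ser_comp], since coefficients need not commute. *)
Lemma fps_compE (f g : fps K) : g 0%N = 0 ->
  fps_comp f g = fpsC (f 0%N) + fps_comp (fps_shift f) g * g.
Proof.
move=> g0; apply/funext => n.
rewrite fpsD (@fps_comp_trunc _ _ n n.+2) // big_ord_recl /=; congr (_ + _).
  by rewrite expr0 fps1 /fpsC; case: eqP => _; rewrite ?mulr1 ?mulr0.
rewrite fpsM.
under eq_bigr do rewrite /bump /= add1n exprSr fpsM mulr_sumr.
rewrite exchange_big; apply: eq_bigr => i _ /=.
rewrite (@fps_comp_trunc _ _ i n.+1) // mulr_suml.
by apply: eq_bigr => k _; rewrite mulrA.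
Qed.

End FpsRing.

Section FpsComRing.
Variable K : comNzRingType.

Fact fps_mulC : commutative (fun f g : fps K => f * g).
Proof.
move=> f g; apply/funext => n; rewrite !fpsM (reindex_inj rev_ord_inj) /=.
by apply: eq_bigr => i _; rewrite subSS subKn 1?mulrC // -ltnS.
Qed.

HB.instance Definition _ := GRing.PzRing_hasCommutativeMul.Build (fps K) fps_mulC.

Implicit Types f g h x y : fps K.

Lemma fps_comp_rec f g : g 0%N = 0 ->
  fps_comp f g = fpsC (f 0%N) + g * fps_comp (fps_shift f) g.
Proof. by move=> g0; rewrite fps_compE // mulrC. Qed.

Lemma fpsX0 : (fpsX K) 0%N = 0. Proof. by []. Qed.

Lemma fps_compD f1 f2 g : fps_comp (f1 + f2) g = fps_comp f1 g + fps_comp f2 g.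
Proof.
apply/funext => n; rewrite fpsD /fps_comp /ser_comp -big_split.
by apply: eq_bigr => k _; rewrite fpsD mulrDl.
Qed.

Lemma fps_compCM c f g : fps_comp (fpsC c * f) g = fpsC c * fps_comp f g.
Proof.
apply/funext => n; rewrite fpsCM /fps_comp /ser_comp mulr_sumr.
by apply: eq_bigr => k _; rewrite fpsCM mulrA.
Qed.

Lemma fps_compC c g : g 0%N = 0 -> fps_comp (fpsC c) g = fpsC c.
Proof.
move=> g0; rewrite fps_comp_rec //.
have -> : fps_comp (fps_shift (fpsC c)) g = 0.
  by apply/funext => n; apply: big1 => k _; rewrite mul0r.
by rewrite mulr0 addr0.
Qed.

Lemma fps_compXM f g : g 0%N = 0 -> fps_comp (fpsX K * f) g = g * fps_comp f g.
Proof.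
move=> g0; rewrite fps_comp_rec // fpsM0 fpsX0 mul0r.
rewrite (_ : fpsC 0 = 0); last by apply/funext => -[].
by rewrite add0r; congr (_ * fps_comp _ _); apply/funext => n; rewrite /fps_shift fpsXM.
Qed.

(** Writing f1 = f1(0) + z h reduces the claim for [f1] to the claim for [h] multiplied by [g].
    Since [g] is divisible by z, one order of precision is gained, and the induction on the order
    treats all [f1] at once. *)
Lemma fps_compM f1 f2 g : g 0%N = 0 ->
  fps_comp (f1 * f2) g = fps_comp f1 g * fps_comp f2 g.
Proof.
move=> g0; apply: agreeP => n; elim: n f1 => // n IH f1.
rewrite (fps_shiftE f1) mulrDl !fps_compD fps_compCM fps_compC // mulrDl.
rewrite -mulrA !fps_compXM //.
by rewrite -mulrA; apply: agreeD => //; apply: agree_mulS.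
Qed.

Lemma fps_comp0E f g : g 0%N = 0 -> fps_comp f g 0%N = f 0%N.
Proof. by move=> g0; rewrite fps_comp_rec // fpsD fpsM0 g0 mul0r addr0. Qed.

Lemma fps_compA f g h : g 0%N = 0 -> h 0%N = 0 ->
  fps_comp (fps_comp f g) h = fps_comp f (fps_comp g h).
Proof.
move=> g0 h0; have gh0 : fps_comp g h 0%N = 0 by rewrite fps_comp0E.
apply: agreeP => n; elim: n f => // n IH f.
rewrite (fps_comp_rec f g0) (fps_comp_rec f gh0) fps_compD fps_compC // fps_compM //.
by apply: agreeD => //; apply: agree_mulS.
Qed.

Lemma agree_fps_comp n f g h : g 0%N = 0 -> h 0%N = 0 ->
  agree n g h -> agree n (fps_comp f g) (fps_comp f h).
Proof.
(* The precision [m] of the conclusion is separated from the order [n] at which [g] and [h] agree,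
   because only [m] decreases. *)
move=> g0 h0 gh; elim: {-2}n (leqnn n) f => // m IH mn f.
rewrite (fps_comp_rec _ g0) (fps_comp_rec _ h0); apply: agreeD => //.
apply: (@agree_trans _ _ _ (g * fps_comp (fps_shift f) h)).
  by apply: agree_mulS => //; apply: IH; apply: ltnW.
by apply: agreeM => // i im; apply: gh; apply: leq_trans im mn.
Qed.

(* Multiplication by z makes the right-hand side depend on fewer coefficients. *)
Lemma fps_comp_fixpoint_unique f g x y :
  x = fps_comp f (fpsX K * g * (1 + x)) -> y = fps_comp f (fpsX K * g * (1 + y)) -> x = y.
Proof.
move=> xE yE; apply: agreeP; elim=> // n IH; rewrite xE yE.
have z0 u : (fpsX K * g * u) 0%N = 0 by rewrite !fpsM0 fpsX0 !mul0r.
apply: agree_fps_comp => //; rewrite -!mulrA.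
by apply: agree_mulS => //; apply: agreeM => //; apply: agreeD.
Qed.

(** Supplies the candidate for the moment series of a product [a * b], to which
    [free_product_moments] then applies. *)
Lemma fps_comp_fixpoint_exists f : exists x, x = fps_comp f (fpsX K * x).
Proof.
pose F (x : nat -> K) : nat -> K := fps_comp f (fpsX K * (x : fps K)).
have [|x [xE _]] := @triangular_system nat K 0 id F.
  move=> x y n xy.
  have xy' : agree n.+1 (fpsX K * (x : fps K)) (fpsX K * (y : fps K)).
    exact: agree_mulS.
  by apply: (agree_fps_comp _ _ _ xy'); rewrite // fpsM0 mul0r.
by exists x; apply/funext.
Qed.

End FpsComRing.

(** * Sums over non-crossing partitions *)

Section NoncrossingPartitions.
Local Open Scope set_scope.

Section NoncrossingSums.
Variables (K : comNzRingType) (n : nat).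
Implicit Types (A B C : {set 'I_n}) (P Q : {set {set 'I_n}}).

Lemma partition_blocksP P A :
  finset.partition P A <->
  [/\ forall B, B \in P -> B != finset.set0,
      forall B x, B \in P -> x \in B -> x \in A,
      forall x, x \in A -> exists2 B, B \in P & x \in B &
      forall B C x, B \in P -> C \in P -> x \in B -> x \in C -> B = C].
Proof.
split=> [pP|[ne sub cov uni]].
  have [/eqP cP /finset.trivIsetP tP P0] := and3P pP; split.
  - by move=> B BP; apply: contraNneq P0 => <-.
  - by move=> B x BP xB; rewrite -cP; apply/finset.bigcupP; exists B.
  - by move=> x; rewrite -cP => /finset.bigcupP[B BP xB]; exists B.
  - move=> B C x BP CP xB xC; apply/eqP; apply: contraT => BC.
    by have /fintype.pred0P/(_ x)/= := tP _ _ BP CP BC; rewrite xB xC.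
apply/and3P; split.
- apply/eqP/setP => x; apply/finset.bigcupP/idP => [[B BP xB]|/cov[B BP xB]].
    exact: sub xB.
  by exists B.
- apply/finset.trivIsetP => B C BP CP; apply: contraNT => /fintype.pred0Pn[x /=].
  by case/andP => xB xC; apply/eqP; apply: uni xB xC.
- by apply/negP => /ne; rewrite eqxx.
Qed.

Lemma noncrossingP P :
  noncrossing P <-> forall V W (a b c d : 'I_n), V \in P -> W \in P ->
    a \in V -> b \in W -> c \in V -> d \in W -> (a < b < c)%N -> (c < d)%N ->
    V = W.
Proof.
split=> [ncP V W a b c d VP WP aV bW cV dW /andP[ab bc] cd|H].
  apply/eqP; apply: contraT => VW.
  have /implyP/(_ VW) := forall_inP (forall_inP ncP V VP) W WP.
  move=> /forall_inP/(_ a aV)/forall_inP/(_ b bW)/forall_inP/(_ c cV).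
  by move=> /forall_inP/(_ d dW); rewrite ab bc cd.
apply/forall_inP => V VP; apply/forall_inP => W WP; apply/implyP => VW.
apply/forall_inP => a aV; apply/forall_inP => b bW; apply/forall_inP => c cV.
apply/forall_inP => d dW; apply/negP => /and3P[ab bc cd].
by case/eqP: VW; apply: (H V W a b c d); rewrite // ab bc.
Qed.

(** The ambient ['I_n] stays fixed while the underlying set varies, so that the pieces of a
    partition keep the type of the whole. *)
Definition NC_on A : {set {set {set 'I_n}}} :=
  [set P | finset.partition P A & noncrossing P].

Lemma NC_onP P A :
  reflect (finset.partition P A /\ noncrossing P) (P \in NC_on A).
Proof. by rewrite inE; apply: andP. Qed.

Definition NC_sum (f : {set 'I_n} -> K) A : K :=
  \sum_(P in NC_on A) \prod_(B in P) f B.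

(* C is the part already read of a block, A the positions still to be read. *)
Definition NC_sum_block (f : {set 'I_n} -> K) C A : K :=
  \sum_(P in NC_on (C :|: A) | [exists B in P, C \subset B]) \prod_(B in P) f B.

Definition splits A1 A2 P : bool :=
  [forall B in P, (B \subset A1) || (B \subset A2)].

Lemma splitsP A1 A2 P :
  reflect (forall B, B \in P -> B \subset A1 \/ B \subset A2) (splits A1 A2 P).
Proof.
by apply: (iffP forall_inP) => H B /H /orP.
Qed.

Section Split.
Variables A1 A2 : {set 'I_n}.
Hypothesis dA : forall x, x \in A1 -> x \in A2 -> False.
Hypothesis convexA1 : forall a b c : 'I_n,
  a \in A1 -> b \in A2 -> c \in A1 -> (a < b < c)%N -> False.

Lemma partition_restrict P : finset.partition P (A1 :|: A2) -> splits A1 A2 P ->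
  finset.partition (P ::&: A1) A1 /\ finset.partition (P ::&: A2) A2.
Proof.
move=> /partition_blocksP[ne sub cov uni] /splitsP sP.
split; apply/partition_blocksP; split.
- by move=> B; rewrite inE => /andP[/ne].
- by move=> B x; rewrite inE => /andP[_ /fintype.subsetP]; apply.
- move=> x xA; have [|B BP xB] := cov x; first by rewrite inE xA.
  exists B => //; rewrite inE BP; have [//|/fintype.subsetP/(_ x xB) xA2] := sP B BP.
  by case: (dA xA).
- by move=> B C x; rewrite !inE => /andP[BP _] /andP[CP _]; apply: uni.
- by move=> B; rewrite inE => /andP[/ne].
- by move=> B x; rewrite inE => /andP[_ /fintype.subsetP]; apply.
- move=> x xA; have [|B BP xB] := cov x; first by rewrite inE xA orbT.
  exists B => //; rewrite inE BP; have [/fintype.subsetP/(_ x xB) xA1|//] := sP B BP.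
  by case: (dA xA1 xA).
- by move=> B C x; rewrite !inE => /andP[BP _] /andP[CP _]; apply: uni.
Qed.

Lemma partition_union P1 P2 :
  finset.partition P1 A1 -> finset.partition P2 A2 ->
  [/\ finset.partition (P1 :|: P2) (A1 :|: A2), splits A1 A2 (P1 :|: P2),
      (P1 :|: P2) ::&: A1 = P1 & (P1 :|: P2) ::&: A2 = P2].
Proof.
move=> /partition_blocksP[ne1 sub1 cov1 uni1].
move=> /partition_blocksP[ne2 sub2 cov2 uni2].
have s1 B : B \in P1 -> B \subset A1.
  by move=> BP; apply/fintype.subsetP => x; apply: sub1.
have s2 B : B \in P2 -> B \subset A2.
  by move=> BP; apply/fintype.subsetP => x; apply: sub2.
split.
- apply/partition_blocksP; split.
  + by move=> B; rewrite inE => /orP[/ne1|/ne2].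
  + move=> B x; rewrite !inE => /orP[/sub1 s|/sub2 s] /s -> //.
    by rewrite orbT.
  + move=> x; rewrite inE => /orP[/cov1|/cov2] [B BP xB]; exists B => //.
      by rewrite inE BP.
    by rewrite inE BP orbT.
  + move=> B C x; rewrite !inE => /orP[BP|BP] /orP[CP|CP] xB xC.
    * exact: uni1 xB xC.
    * by case: (dA (sub1 _ _ BP xB) (sub2 _ _ CP xC)).
    * by case: (dA (sub1 _ _ CP xC) (sub2 _ _ BP xB)).
    * exact: uni2 xB xC.
- by apply/splitsP => B; rewrite inE => /orP[/s1|/s2]; [left|right].
- apply/setP => B; rewrite !inE; apply/andP/idP => [[/orP[//|BP] BA]|BP].
    have /finset.set0Pn[x xB] := ne2 _ BP.
    by case: (dA (fintype.subsetP BA _ xB) (sub2 _ _ BP xB)).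
  by rewrite BP s1.
- apply/setP => B; rewrite !inE; apply/andP/idP => [[/orP[BP|//] BA]|BP].
    have /finset.set0Pn[x xB] := ne1 _ BP.
    by case: (dA (sub1 _ _ BP xB) (fintype.subsetP BA _ xB)).
  by rewrite BP orbT s2.
Qed.

(** A crossing a < b < c < d between a block in [A1] and one in [A2] would put an element of [A2]
    strictly between two of [A1]: b if the block in [A1] holds a and c, and c if it holds b and
    d. *)
Lemma noncrossing_union P1 P2 :
  finset.partition P1 A1 -> finset.partition P2 A2 ->
  noncrossing (P1 :|: P2) = noncrossing P1 && noncrossing P2.
Proof.
move=> /partition_blocksP[_ sub1 _ _] /partition_blocksP[_ sub2 _ _].
apply/idP/andP => [/noncrossingP nc|[/noncrossingP nc1 /noncrossingP nc2]].
  by split; apply/noncrossingP => V W a b c d VP WP; apply: nc;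
     rewrite inE ?VP ?WP ?orbT.
apply/noncrossingP => V W a b c d.
rewrite !inE => /orP[VP|VP] /orP[WP|WP] aV bW cV dW abc cd.
- exact: (nc1 V W a b c d).
- by case: (convexA1 (sub1 _ _ VP aV) (sub2 _ _ WP bW) (sub1 _ _ VP cV) abc).
- case: (convexA1 (sub1 _ _ WP bW) (sub2 _ _ VP cV) (sub1 _ _ WP dW)).
  by case/andP: abc => _ ->.
- exact: (nc2 V W a b c d).
Qed.

(** Restriction to the two sides is inverse to union, whence the product. The predicate [q] carries
    the condition on the block under construction, which lies over [A2]. *)
Lemma NC_sum_split (f : {set 'I_n} -> K) (q : pred {set {set 'I_n}}) :
  \sum_(P in NC_on (A1 :|: A2) | splits A1 A2 P && q (P ::&: A2))
     \prod_(B in P) f B =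
  NC_sum f A1 * \sum_(P in NC_on A2 | q P) \prod_(B in P) f B.
Proof.
rewrite /NC_sum big_distrlr /=.
rewrite (eq_bigr _ (fun _ _ => erefl)) pair_big_dep /=.
rewrite (reindex_onto (fun p => p.1 :|: p.2)
  (fun P => (P ::&: A1, P ::&: A2))) /=.
  apply: eq_big => [[P1 P2] /=|[P1 P2] /=].
    apply/andP/and3P.
      case=> /and3P[/NC_onP[pP ncP] sP qP] /eqP[E1 E2].
      have [p1 p2] := partition_restrict pP sP; rewrite E1 in p1; rewrite E2 in p2.
      have := ncP; rewrite noncrossing_union // => /andP[nc1 nc2].
      by split; [apply/NC_onP|apply/NC_onP|rewrite -E2].
    case=> /NC_onP[p1 nc1] /NC_onP[p2 nc2] qP.
    have [pP sP E1 E2] := partition_union p1 p2.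
    rewrite E1 E2 qP sP; split=> //; rewrite !andbT; apply/NC_onP; split => //.
    by rewrite noncrossing_union // nc1.
  case/andP => /and3P[/NC_onP[pP ncP] sP qP] /eqP[E1 E2].
  rewrite (eq_bigl [in [predU P1 & P2]]) => [|B]; last by rewrite !inE.
  rewrite bigU //=.
  apply/fintype.pred0P => B /=; apply/negP => /andP[B1 B2].
  have := B1; rewrite -E1 inE => /andP[BP /fintype.subsetP BA1].
  have := B2; rewrite -E2 inE => /andP[_ /fintype.subsetP BA2].
  have /partition_blocksP[ne _ _ _] := pP.
  by have /finset.set0Pn[x xB] := ne _ BP; apply: dA (BA1 x xB) (BA2 x xB).
move=> P /and3P[_ /splitsP sP _] /=; apply/setP => B; rewrite !inE.
by apply/orP/idP => [[/andP[]|/andP[]]//|BP]; rewrite BP; exact: sP.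
Qed.

End Split.

Lemma NC_sum0 f : NC_sum f finset.set0 = 1.
Proof.
rewrite /NC_sum (big_pred1 finset.set0) ?finset.big_set0 // => P /=.
apply/NC_onP/eqP => [[/partition_blocksP[ne sub _ _] _]|->].
  apply/setP => B; rewrite inE; apply/negP => BP.
  by have /finset.set0Pn[x /(sub _ _ BP)] := ne _ BP; rewrite inE.
split; first by apply/partition_blocksP; split=> [?|? ?|?|? ? ?]; rewrite inE.
by apply/noncrossingP => V W a b c d; rewrite inE.
Qed.

Section Recursion.
Variables (f : {set 'I_n} -> K) (C A : {set 'I_n}).
Hypothesis C0 : C != finset.set0.
Hypothesis ltCA : forall c a : 'I_n, c \in C -> a \in A -> (c < a)%N.

Let notCA c : c \in C -> c \in A -> False.
Proof. by move=> cC cA; have := ltCA cC cA; rewrite ltnn. Qed.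

(** The case in which the block read so far is complete. The split has [A] as its convex side: [C]
    precedes all of [A]. *)
Lemma NC_sum_block_closed :
  \sum_(P in NC_on (C :|: A) | [exists B in P, C \subset B] && (C \in P))
    \prod_(B in P) f B = f C * NC_sum f A.
Proof.
rewrite mulrC.
have -> : f C = \sum_(P in NC_on C | C \in P) \prod_(B in P) f B.
  rewrite (big_pred1 [set C]) ?finset.big_set1 // => P.
  apply/andP/eqP => [[/NC_onP[/partition_blocksP[ne sub cov uni] _] CP]|->].
    apply/setP => B; rewrite inE; apply/idP/eqP => [BP|-> //].
    have /finset.set0Pn[x xB] := ne _ BP.
    exact: uni xB (sub _ _ BP xB).
  rewrite finset.set11; split=> //; apply/NC_onP; split.
    apply/partition_blocksP; split=> [B|B x|x|B D x]; rewrite ?inE.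
    - by move/eqP->.
    - by move/eqP->.
    - by move=> xC; exists C; rewrite ?inE.
    - by move=> /eqP-> /eqP->.
  by apply/noncrossingP => V W a b c d; rewrite !inE => /eqP-> /eqP->.
rewrite -(@NC_sum_split A C _ _ f (fun P => C \in P)).
- rewrite finset.setUC; apply: eq_bigl => P.
  rewrite [C \in _ ::&: _]inE fintype.subxx andbT.
  apply/and3P/and3P => [[PNC _ CP]|[PNC _ CP]]; split=> //; last first.
    by apply/existsP; exists C; rewrite CP /=.
  have /NC_onP[/partition_blocksP[ne sub cov uni] _] := PNC.
  apply/splitsP => B BP; have [->|BC] := eqVneq B C; first by right.
  left; apply/fintype.subsetP => x xB; have := sub _ _ BP xB; rewrite inE.
  by case/orP => // xC; case/eqP: BC; apply: uni xB xC.
- by move=> x xA xC; apply: notCA xC xA.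
- move=> a b c aA bC _ /andP[ab _].
  by have := ltn_trans ab (ltCA bC aA); rewrite ltnn.
Qed.

Definition next_in_block P (y : 'I_n) :=
  [exists B in P, [&& C \subset B, y \in B, y \notin C &
     [forall z in B, (z \in C) || (y <= z)%N]]].

(** The positions of [A] before [y] are enclosed between [C] and [y], which share a block, so the
    partition splits into these positions and the rest. Over the rest, the block under construction
    starts with [y |: C]. *)
Lemma NC_sum_block_next y : y \in A ->
  \sum_(P in NC_on (C :|: A) | [exists B in P, C \subset B] && next_in_block P y)
    \prod_(B in P) f B =
  NC_sum f [set a in A | (a < y)%N] *
  NC_sum_block f (y |: C) [set a in A | (y < a)%N].
Proof.
move=> yA; set A1 := [set a in A | (a < y)%N].
set A3 := [set a in A | (y < a)%N]; set A2 := y |: C :|: A3.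
have yC : y \notin C by apply/negP => /notCA/(_ yA).
have A2P x : reflect [\/ x = y, x \in C | x \in A /\ (y < x)%N] (x \in A2).
  rewrite !inE -orbA; apply: (iffP or3P) => -[].
  - by move/eqP; constructor 1.
  - by constructor 2.
  - by move/andP; constructor 3.
  - by move/eqP; constructor 1.
  - by constructor 2.
  - by move/andP; constructor 3.
have A1P x : reflect (x \in A /\ (x < y)%N) (x \in A1) by rewrite inE; apply: andP.
rewrite /NC_sum_block -/A2.
rewrite -(@NC_sum_split A1 A2 _ _ f (fun P => [exists B in P, y |: C \subset B])).
- have -> : A1 :|: A2 = C :|: A.
    apply/setP => x; rewrite !inE.
    have [->|xy] := eqVneq x y; first by rewrite yA !orbT.
    have [|_] /= := boolP (x \in C); first by rewrite orbT.
    case: (x \in A) => //=; case: (ltngtP x y) => //= /val_inj/eqP.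
    by rewrite (negbTE xy).
  apply: eq_bigl => P; apply/and3P/and3P.
    case=> PNC _ /existsP[B /and5P[BP CB yB _ /forall_inP minB]].
    have /NC_onP[/partition_blocksP[ne sub cov uni] /noncrossingP nc] := PNC.
    have BA2 : B \subset A2.
      apply/fintype.subsetP => z zB; apply/A2P.
      have [zC|zC] := boolP (z \in C); first by constructor 2.
      have [->|zy] := eqVneq z y; first by constructor 1.
      constructor 3; have := sub _ _ BP zB; rewrite inE (negbTE zC) /= => zA.
      have := minB z zB; rewrite (negbTE zC) /= leq_eqVlt => /orP[|//].
      by move/eqP/val_inj/esym/eqP; rewrite (negbTE zy).
    split=> //; last first.
      apply/existsP; exists B; rewrite inE BP BA2 /=.
      by rewrite finset.subUset finset.sub1set yB CB.
    apply/splitsP => V VP; have [->|VB] := eqVneq V B; first by right.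
    have VnB x : x \in V -> x \in B -> False.
      by move=> xV xB; case/eqP: VB; apply: uni xV xB.
    have VA x : x \in V -> x \in A.
      move=> xV; have := sub _ _ VP xV; rewrite inE => /orP[xC|//].
      by case: (VnB _ xV); apply: (fintype.subsetP CB).
    have Vy x : x \in V -> x != y.
      by move=> xV; apply/eqP => xy; case: (VnB _ xV); rewrite xy.
    have [[v /andP[vV vy]]|H] :=
        pselect (exists v, (v \in V) && (v < y)%N); last first.
      right; apply/fintype.subsetP => x xV; apply/A2P; constructor 3.
      split; first exact: VA.
      have := Vy x xV; rewrite -val_eqE /= neq_ltn => /orP[xy|//].
      by case: H; exists x; rewrite xV.
    (* Once [V] has an element [v] left of [y] it stays there: an element [x] of [V] beyond [y]
       would give the crossing c < v < y < x with c in [C]. *)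
    left; apply/fintype.subsetP => x xV; apply/A1P; split; first exact: VA.
    have := Vy x xV; rewrite -val_eqE /= neq_ltn => /orP[//|yx].
    have /finset.set0Pn[c cC] := C0.
    case/eqP: VB; apply/esym/(nc B V c v y x) => //.
      exact: (fintype.subsetP CB).
    by rewrite vy andbT; apply: ltCA => //; apply: VA.
  case=> PNC _ /existsP[B /andP[]].
  rewrite inE => /andP[BP /fintype.subsetP BA2].
  rewrite finset.subUset finset.sub1set => /andP[yB CB]; split=> //.
    by apply/existsP; exists B; rewrite BP.
  apply/existsP; exists B; rewrite BP CB yB yC /=.
  apply/forall_inP => z /BA2/A2P[->|->//|[_ /ltnW ->]].
    by rewrite leqnn orbT.
  by rewrite orbT.
- move=> x /A1P[xA xy] /A2P[xy'|/notCA/(_ xA)//|[_ yx]].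
    by rewrite xy' ltnn in xy.
  by have := ltn_trans xy yx; rewrite ltnn.
- move=> a b c /A1P[aA ay] /A2P[->|bC|[_ yb]] /A1P[cA cy] /andP[ab bc].
  + by have := ltn_trans bc cy; rewrite ltnn.
  + by have := ltn_trans ab (ltCA bC aA); rewrite ltnn.
  + by have := ltn_trans yb (ltn_trans bc cy); rewrite ltnn.
Qed.

(** A block extending [C] either equals [C] or has a least further element [y]; iterating this reads
    the block from left to right. *)
Lemma NC_sum_block_rec :
  NC_sum_block f C A = f C * NC_sum f A +
    \sum_(y in A) NC_sum f [set a in A | (a < y)%N] *
                  NC_sum_block f (y |: C) [set a in A | (y < a)%N].
Proof.
rewrite -NC_sum_block_closed.
under [X in _ = _ + X]eq_bigr do rewrite -NC_sum_block_next //.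
rewrite /NC_sum_block (bigID (fun P => C \in P)) /=; congr (_ + _).
  by apply: eq_bigl => P; rewrite andbA.
(* A partition in which [C] is not a whole block is counted for exactly one [y], the least element
   outside [C] of the block containing [C]. *)
rewrite (exchange_big_dep (fun P => (P \in NC_on (C :|: A)) &&
  [exists B in P, C \subset B] && (C \notin P))) /=.
  apply: eq_bigr => P /andP[/andP[PNC /existsP[B /andP[BP CB]]] CP].
  have /NC_onP[/partition_blocksP[ne sub cov uni] /noncrossingP nc] := PNC.
  have /finset.set0Pn[c cC] := C0; have cB := fintype.subsetP CB c cC.
  have Bu D : D \in P -> C \subset D -> D = B.
    by move=> DP /fintype.subsetP CD; apply: uni (CD _ cC) cB.
  have [y0 /andP[y0B y0C]] : exists y0, (y0 \in B) && (y0 \notin C).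
    apply/existsP; apply: contraNT CP => /existsPn H.
    suff -> : C = B by [].
    apply/eqP; rewrite finset.eqEsubset CB /=; apply/fintype.subsetP => x xB.
    by have := H x; rewrite xB /= negbK.
  have [y /andP[yB yC] ymin] := @arg_minnP _ y0
    (fun y => (y \in B) && (y \notin C)) (@nat_of_ord n) (introT andP (conj y0B y0C)).
  have nP z : next_in_block P z = (z == y).
    apply/existsP/eqP => [[D /and5P[DP CD zD zC /forall_inP zmin]]|->].
      rewrite (Bu D DP CD) in zD zmin.
      apply/val_inj/eqP; rewrite eqn_leq /= ymin ?zD // andbT.
      by have := zmin _ yB; rewrite (negbTE yC).
    exists B; rewrite BP CB yB yC /=; apply/forall_inP => x xB.
    by have [//|xC /=] := boolP (x \in C); apply: ymin; rewrite xB.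
  rewrite (big_pred1 y) // => z /=; rewrite nP PNC.
  have -> /= : [exists B0 in P, C \subset B0] by apply/existsP; exists B; rewrite BP.
  have [->|] := eqVneq z y; last by rewrite andbF.
  by rewrite andbT; have := sub _ _ BP yB; rewrite inE (negbTE yC).
move=> y P yA /and3P[PNC eB /existsP[B /and5P[BP CB yB yC _]]].
rewrite PNC eB /=; apply/negP => CP.
have /NC_onP[/partition_blocksP[ne sub cov uni] _] := PNC.
have /finset.set0Pn[c cC] := C0; have cB := fintype.subsetP CB c cC.
by case/negP: yC; rewrite (uni C B c).
Qed.

End Recursion.

Lemma NC_sum_min f A (x : 'I_n) : (forall a, a \in A -> (x < a)%N) ->
  NC_sum f (x |: A) = NC_sum_block f [set x] A.
Proof.
move=> xA; apply: eq_bigl => P; case: NC_onP => //= -[].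
move=> /partition_blocksP[_ _ cov _] _; apply/esym/existsP.
have [|B BP xB] := cov x; first by rewrite !inE eqxx.
by exists B; rewrite BP finset.sub1set.
Qed.

End NoncrossingSums.

Lemma sorted_enum_set n (B : {set 'I_n}) :
  sorted (fun i j : 'I_n => (i < j)%N) (enum B).
Proof.
rewrite /enum_mem -enumT; apply: sorted_filter.
  by move=> y x z; apply: ltn_trans.
by have := iota_ltn_sorted 0 n; rewrite -val_enum_ord sorted_map.
Qed.

(** An increasing list is determined by its elements. Since [subword] reads [enum], the word of a
    union or an image is found by exhibiting an increasing list. *)
Lemma enum_set_sorted n (B : {set 'I_n}) (s : seq 'I_n) :
  sorted (fun i j : 'I_n => (i < j)%N) s -> s =i B -> enum B = s.
Proof.
move=> sS sB; apply: (@irr_sorted_eq _ (fun i j : 'I_n => (i < j)%N)) => //.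
- by move=> y x z; apply: ltn_trans.
- by move=> x; apply: ltnn.
- exact: sorted_enum_set.
- by move=> x; rewrite mem_enum sB.
Qed.

Lemma subword_rcons (w : word) (C : {set 'I_(size w)}) (y : 'I_(size w)) :
  (forall c : 'I_(size w), c \in C -> (c < y)%N) ->
  subword (y |: C) = rcons (subword C) (tnth (in_tuple w) y).
Proof.
move=> Cy; rewrite /subword (@enum_set_sorted _ _ (rcons (enum C) y)).
- by rewrite map_rcons.
- have tr : transitive (fun i j : 'I_(size w) => (i < j)%N).
    by move=> b a c; apply: ltn_trans.
  rewrite (sorted_pairwise tr) -cats1 pairwise_cat /= andbT -(sorted_pairwise tr).
  rewrite sorted_enum_set andbT allrel1r; apply/allP => c.
  by rewrite mem_enum; apply: Cy.
- by move=> x; rewrite mem_rcons !inE mem_enum.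
Qed.

Section Transport.
Variables (K : comNzRingType) (m n : nat) (h : 'I_m -> 'I_n).
Hypothesis hmono : forall i j : 'I_m, (i < j)%N -> (h i < h j)%N.

Let h_inj : injective h.
Proof.
move=> i j hij; apply/val_inj; case: (ltngtP i j) => // /hmono;
by rewrite hij ltnn.
Qed.

Let h_lt i j : (h i < h j)%N -> (i < j)%N.
Proof.
case: (ltngtP i j) => // [/hmono ji ij|/val_inj->]; last by rewrite ltnn.
by have := ltn_trans ij ji; rewrite ltnn.
Qed.

(** An increasing map preserves and reflects crossings. This turns the sum over a gap into the sum
    over a word of its own, so that moments of shorter words appear. *)
Lemma NC_sum_imset (f : {set 'I_n} -> K) :
  NC_sum f (h @: [set: 'I_m]) = NC_sum (fun B => f (h @: B)) [set: 'I_m].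
Proof.
have himI : injective (fun B : {set 'I_m} => h @: B) by apply: imset_inj.
pose push (P : {set {set 'I_m}}) := [set h @: (B : {set 'I_m}) | B in P].
pose pull (Q : {set {set 'I_n}}) : {set {set 'I_m}} :=
  [set B | (h @: (B : {set 'I_m})) \in Q].
have pushK P : pull (push P) = P.
  by apply/setP => B; rewrite inE mem_imset.
have pullK Q : Q \in NC_on (h @: [set: 'I_m]) -> push (pull Q) = Q.
  case/NC_onP => /partition_blocksP[ne sub cov uni] _.
  apply/setP => B; apply/imsetP/idP => [[D]|BQ]; first by rewrite inE => ? ->.
  suff BE : B = h @: (h @^-1: B) by exists (h @^-1: B); rewrite // inE -BE.
  apply/setP => x; apply/idP/imsetP => [xB|[y]]; last by rewrite inE => ? ->.
  by have /imsetP[y _ xy] := sub _ _ BQ xB; exists y; rewrite // inE -xy.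
rewrite /NC_sum (reindex_onto push pull pullK) /=.
apply: eq_big => P; last first.
  by move=> _; rewrite big_imset //= => B D _ _; apply: himI.
rewrite pushK eqxx andbT; apply/NC_onP/NC_onP.
  case=> /partition_blocksP[ne sub cov uni] /noncrossingP nc; split.
    apply/partition_blocksP; split=> //.
    - move=> B BP; have := ne (h @: B) (imset_f _ BP).
      by apply: contraNneq => ->; rewrite imset0.
    - move=> x _; have [|D /imsetP[B BP ->]] := cov (h x).
        by apply: imset_f.
      by rewrite mem_imset // => xB; exists B.
    - move=> B C x BP CP xB xC; apply: himI.
      by apply: (uni _ _ (h x)); rewrite imset_f.
  apply/noncrossingP => V W a b c d VP WP aV bW cV dW /andP[ab bc] cd.
  apply: himI; apply: (nc _ _ (h a) (h b) (h c) (h d)); rewrite ?imset_f //.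
    by rewrite !hmono.
  exact: hmono.
case=> /partition_blocksP[ne sub cov uni] /noncrossingP nc; split.
  apply/partition_blocksP; split.
  - move=> _ /imsetP[B BP ->]; have /finset.set0Pn[x xB] := ne _ BP.
    by apply/finset.set0Pn; exists (h x); apply: imset_f.
  - by move=> _ _ /imsetP[B BP ->] /imsetP[x xB ->]; apply: imset_f.
  - move=> _ /imsetP[x _ ->]; have [//|B BP xB] := cov x.
    by exists (h @: B); apply: imset_f.
  - move=> _ _ _ /imsetP[B BP ->] /imsetP[C CP ->] /imsetP[x xB ->].
    by rewrite mem_imset // => xC; rewrite (uni B C x).
apply/noncrossingP => _ _ a b c d /imsetP[V VP ->] /imsetP[W WP ->].
case/imsetP => a' aV -> /imsetP[b' bW ->] /imsetP[c' cV ->] /imsetP[d' dW ->].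
case/andP => /h_lt ab /h_lt bc /h_lt cd.
by rewrite (nc V W a' b' c' d') // ab bc.
Qed.

End Transport.

Definition interval n k m : {set 'I_n} := [set i : 'I_n | (k <= i < m)%N].

Lemma big_interval (K : nmodType) n k (G : nat -> K) : (k <= n)%N ->
  \sum_(y in interval n k n) G (y - k)%N = \sum_(i < n - k) G i.
Proof.
move=> kn; rewrite (eq_bigl (fun y : 'I_n => (k <= y)%N)); last first.
  by move=> y; rewrite inE ltn_ord andbT.
rewrite -(big_mkord (fun y => (k <= y)%N) (fun y => G (y - k)%N)).
rewrite (big_cat_nat (n := k)) //= big_nat_cond big1 ?add0r; last first.
  by move=> i /andP[/andP[_ ik]]; rewrite leqNgt ik.
rewrite -{1}[k]add0n big_addn big_mkord.
by apply: eq_big => [i|i _]; rewrite ?leq_addl ?addnK.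
Qed.

Lemma sum_even (K : nmodType) (G : nat -> K) j :
  \sum_(i < j.*2) (if odd i then 0 else G i./2) = \sum_(i < j) G i.
Proof.
elim: j => [|j IH]; first by rewrite !big_ord0.
rewrite doubleS !big_ord_recr /= odd_double doubleK IH.
by rewrite addr0.
Qed.

Lemma sum_even_odd (K : nmodType) (G : nat -> K) j :
  \sum_(i < j.*2.+1) (if odd i then 0 else G i./2) = \sum_(i < j.+1) G i.
Proof. by rewrite !big_ord_recr /= odd_double doubleK sum_even. Qed.

(** Replaces the powers of [word_ZZs] and [word_ZsZ], because reading a block letter by letter also
    meets alternating words of odd length. *)
Fixpoint alt_word (b : bool) (k : nat) : word :=
  if k is k'.+1 then b :: alt_word (~~ b) k' else [::].

Lemma size_alt_word b k : size (alt_word b k) = k.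
Proof. by elim: k b => //= k IH b; rewrite IH. Qed.

Lemma nth_alt_word x b k i :
  (i < k)%N -> nth x (alt_word b k) i = b (+) odd i.
Proof.
elim: k b i => // k IH b [|i] /=; first by rewrite addbF.
by rewrite ltnS => /IH ->; rewrite addNb addbN.
Qed.

Lemma drop_alt_word b k i :
  drop i (alt_word b k) = alt_word (b (+) odd i) (k - i).
Proof.
elim: k b i => [b [|i]|k IH b [|i]] //=; first by rewrite addbF.
by rewrite IH subSS addNb addbN.
Qed.

Lemma take_alt_word b k i :
  (i <= k)%N -> take i (alt_word b k) = alt_word b i.
Proof. by elim: k b i => [b [|i]|k IH b [|i]] //= /IH ->. Qed.

Lemma rcons_alt_word b k :
  rcons (alt_word b k) (b (+) odd k) = alt_word b k.+1.
Proof.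
elim: k b => [b|k IH b] /=; first by rewrite addbF.
by have /= <- := IH (~~ b); rewrite addbN addNb.
Qed.

Lemma word_powS w k : word_pow w k.+1 = w ++ word_pow w k.
Proof. by []. Qed.

Lemma word_pow_alt_word b k :
  word_pow (if b then word_ZsZ else word_ZZs) k = alt_word b k.*2.
Proof.
by elim: k => // k IH; rewrite word_powS IH doubleS /=; case: b {IH}.
Qed.

(** * Moments of alternating words when only alternating words of even length have non-zero
    cumulants *)

Section Words.
Variables (K : comNzRingType) (r : word -> K).

Definition word_sum (w : word) : K :=
  NC_sum (fun B : {set 'I_(size w)} => r (subword B)) [set: 'I_(size w)].

Lemma word_sum_nil : word_sum [::] = 1.
Proof.
rewrite /word_sum -[RHS](NC_sum0 (fun B : {set 'I_0} => r (@subword [::] B))).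
by congr NC_sum; apply/setP => -[].
Qed.

Lemma word_sumE (m : word -> K) w : is_R_nser m r -> w <> [::] ->
  word_sum w = m w.
Proof. by move=> [_ /[apply] ->]. Qed.

Lemma NC_sum_interval (w : word) k l : (k + l <= size w)%N ->
  NC_sum (fun B : {set 'I_(size w)} => r (subword B))
    (interval (size w) k (k + l)) = word_sum (take l (drop k w)).
Proof.
move=> kl; set v := take l (drop k w).
have sv : size v = l by rewrite size_takel // size_drop; lia.
have hP (i : 'I_(size v)) : (k + i < size w)%N by have := ltn_ord i; lia.
pose h (i : 'I_(size v)) := Ordinal (hP i).
have -> : interval (size w) k (k + l) = h @: [set: 'I_(size v)].
  apply/setP => x; rewrite inE; apply/idP/imsetP => [/andP[kx xl]|[y _ ->]] /=.
    have xP : (x - k < size v)%N by lia.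
    exists (Ordinal xP); first by rewrite inE.
    by apply: ord_inj => /=; rewrite subnKC.
  by have := ltn_ord y; lia.
have hmono (i j : 'I_(size v)) : (i < j)%N -> (h i < h j)%N.
  by rewrite /= ltn_add2l.
rewrite NC_sum_imset //; apply: eq_bigr => P _; apply: eq_bigr => B _; congr r.
rewrite /subword (@enum_set_sorted _ _ [seq h i | i <- enum B]).
- rewrite -map_comp; apply: eq_map => i /=.
  rewrite !(tnth_nth false) /= nth_take; last by have := ltn_ord i; lia.
  by rewrite nth_drop.
- by rewrite sorted_map; apply: sub_sorted (sorted_enum_set B) => i j /hmono.
- move=> x; apply/mapP/imsetP => -[i iB ->]; exists i => //.
    by rewrite -mem_enum.
  by rewrite mem_enum.
Qed.

Variable alpha : bool -> fps K.
Hypothesis alpha0 : forall b, alpha b 0%N = 0.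
Hypothesis r_alt : forall b m, (0 < m)%N -> r (alt_word b m.*2) = alpha b m.
Hypothesis r_out : forall w, (forall b m, (0 < m)%N -> w <> alt_word b m.*2) ->
  r w = 0.

Definition alt_moments b : fps K := fun j => word_sum (alt_word b j.*2).

Let P : bool -> fps K := alt_moments.
Let D : fps K := fpsX K * P false * P true.

(* The sums NC_sum_block, C carrying an alternating word with m pairs of letters. *)
Definition block_series b m : fps K := P b * fps_comp (iter m (@fps_shift K) (alpha b)) D.

Let D0 : D 0%N = 0. Proof. by rewrite /D !fpsM0 fpsX0 !mul0r. Qed.

Let DE b : D = fpsX K * P b * P (~~ b).
Proof. by case: b => //; rewrite /D mulrAC. Qed.

(** Either the block is complete and what follows contributes [P b], or it receives another pair of
    letters: z counts the pair, [P b] is the gap before its first letter and [P (~~ b)] the gap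
    between the two. *)
Lemma block_seriesE b m : block_series b m =
  fpsC (iter m (@fps_shift K) (alpha b) 0%N) * P b +
  fpsX K * (P b * (P (~~ b) * block_series b m.+1)).
Proof.
rewrite /block_series fps_comp_rec // -iterS {1}(DE b).
by set c := fps_comp _ _; set a := fpsC _; rewrite mulrDr [P b * a]mulrC; ring.
Qed.

Lemma iter_fps_shift m (f : fps K) j : iter m (@fps_shift K) f j = f (j + m)%N.
Proof. by elim: m j => [|m IH] j; rewrite ?addn0 //= /fps_shift IH addSnnS. Qed.

Lemma r_odd_alt_word b c : odd c -> r (alt_word b c) = 0.
Proof.
move=> oc; apply: r_out => b' m _ /(congr1 size).
by rewrite !size_alt_word => E; rewrite E odd_double in oc.
Qed.

(** The first letter of an alternating word determines all others, so a wrong letter [x] is not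
    repaired by any continuation [v]. *)
Lemma r_broken b c x v : (0 < c)%N -> x != b (+) odd c ->
  r (rcons (alt_word b c) x ++ v) = 0.
Proof.
move=> c0 xb; apply: r_out => b' m m0 E; case/eqP: xb.
have lt : (c < m.*2)%N.
  have := congr1 size E.
  rewrite size_cat size_rcons !size_alt_word; lia.
have := congr1 (fun s => nth false s 0) E.
rewrite nth_cat size_rcons /= nth_rcons size_alt_word c0.
rewrite !nth_alt_word //; last by lia.
rewrite !addbF => ->.
have := congr1 (fun s => nth false s c) E.
rewrite nth_cat size_rcons size_alt_word ltnSn.
by rewrite nth_rcons size_alt_word ltnn eqxx nth_alt_word.
Qed.

Section Blocks.
Variable w : word.
Local Notation n := (size w).
Local Notation f := (fun B : {set 'I_n} => r (subword B)).

Lemma NC_sum_block_broken (C : {set 'I_n}) k b c x : (0 < c)%N ->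
  x != b (+) odd c -> subword C = rcons (alt_word b c) x ->
  (forall i : 'I_n, i \in C -> (i < k)%N) ->
  NC_sum_block f C (interval n k n) = 0.
Proof.
move=> c0 xb CE Ck; apply: big1 => Q /andP[/NC_onP[/partition_blocksP[_ sub _ _] _]].
case/existsP => B /andP[BQ CB]; rewrite (bigD1 B) //=.
(* [B] extends [C] only to the right, so its word begins with that of [C] and keeps the broken
   letter. *)
suff -> : subword B = subword C ++ subword (B :\: C).
  by rewrite CE r_broken // mul0r.
rewrite /subword -map_cat; congr map; apply: enum_set_sorted.
  have tr : transitive (fun i j : 'I_n => (i < j)%N).
    by move=> y z t; apply: ltn_trans.
  rewrite (sorted_pairwise tr) pairwise_cat -!(sorted_pairwise tr).
  rewrite !sorted_enum_set !andbT; apply/allrelP => i j.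
  rewrite !mem_enum => /Ck ik; rewrite inE => /andP[jC jB].
  have := sub _ _ BQ jB; rewrite inE (negbTE jC) inE /= => /andP[kj _].
  exact: leq_trans ik kj.
move=> i; rewrite mem_cat !mem_enum inE.
by have [iC|//] := boolP (i \in C); rewrite (fintype.subsetP CB).
Qed.

(** Adding a letter changes the parity of the block, so both parities go through one strong
    induction on the number [l] of unread positions. After an odd number of letters the next gap is
    of the other kind, whence the factor [P (~~ b)]. *)
Lemma NC_sum_block_alt_word l : forall (C : {set 'I_n}) k b m,
  n = (k + l)%N -> (forall i : 'I_n, i \in C -> (i < k)%N) ->
  (forall j, l = j.*2 -> subword C = alt_word b m.+1.*2 ->
     drop k w = alt_word b l ->
     NC_sum_block f C (interval n k n) = block_series b m.+1 j) /\
  (forall j, l = j.*2.+1 -> subword C = alt_word b m.*2.+1 ->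
     drop k w = alt_word (~~ b) l ->
     NC_sum_block f C (interval n k n) = (P (~~ b) * block_series b m.+1) j).
Proof.
have [N] := ubnP l; elim: N l => // N IH l; rewrite ltnS => lN C k b m nE Ck.
have ltC c a : c \in C -> a \in interval n k n -> (c < a)%N.
  by move=> /Ck ck; rewrite inE => /andP[ka _]; apply: leq_trans ck ka.
have C0 c : (0 < c)%N -> subword C = alt_word b c -> C != finset.set0.
  move=> c0 CE; apply/eqP => C0; have := congr1 size CE.
  by rewrite size_map size_alt_word C0 -cardE cards0; lia.
(* A letter added at odd distance from [k] repeats the last letter of the block, and the cumulant
   vanishes. *)
have step c b' : (0 < c)%N -> subword C = alt_word b c ->
    b' = b (+) odd c -> drop k w = alt_word b' l ->
    NC_sum_block f C (interval n k n) = r (alt_word b c) *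
      word_sum (alt_word b' l) +
    \sum_(y in interval n k n) word_sum (alt_word b' (y - k)) *
      (if odd (y - k) then 0 else
       NC_sum_block f (y |: C) (interval n y.+1 n)).
  move=> c0 CE bE dE; rewrite (NC_sum_block_rec _ (C0 _ c0 CE) ltC) CE.
  congr (_ * _ + _).
    have -> : interval n k n = interval n k (k + l) by rewrite -nE.
    by rewrite NC_sum_interval -?nE // dE take_oversize // size_alt_word.
  apply: eq_bigr => y; rewrite inE => /andP[ky yn].
  have -> : [set a in interval n k n | (a < y)%N] = interval n k (k + (y - k)).
    by apply/setP => a; rewrite !inE; have := ltn_ord a; lia.
  rewrite NC_sum_interval; last by lia.
  rewrite dE take_alt_word; last by lia.
  have -> : [set a in interval n k n | (y < a)%N] = interval n y.+1 n.
    by apply/setP => a; rewrite !inE; have := ltn_ord a; lia.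
  congr (_ * _); case: ifP => // oy.
  apply: (@NC_sum_block_broken _ _ b c (tnth (in_tuple w) y)) => //.
  - have -> : tnth (in_tuple w) y = b' (+) odd (y - k).
      rewrite (tnth_nth false) /= -{1}(subnKC ky) -nth_drop dE nth_alt_word //.
      by lia.
    by rewrite oy bE addbT; case: (_ (+) _).
  - rewrite subword_rcons ?CE // => i /Ck ik; exact: leq_trans ik ky.
  - by move=> i; rewrite !inE => /orP[/eqP-> //|/Ck ik]; apply: leq_trans ik _; lia.
have next c b' y : (0 < c)%N -> subword C = alt_word b c ->
    b' = b (+) odd c -> drop k w = alt_word b' l -> y \in interval n k n ->
    ~~ odd (y - k) ->
    [/\ subword (y |: C) = alt_word b c.+1,
        drop y.+1 w = alt_word (~~ b') (l - (y - k).+1) &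
        forall i : 'I_n, i \in y |: C -> (i < y.+1)%N].
  move=> c0 CE bE dE; rewrite inE => /andP[ky yn] oy; split.
  - rewrite subword_rcons; last by move=> i /Ck ik; exact: leq_trans ik ky.
    rewrite CE (_ : tnth _ _ = b (+) odd c) ?rcons_alt_word //.
    rewrite (tnth_nth false) /= -{1}(subnKC ky) -nth_drop dE nth_alt_word.
      by rewrite (negbTE oy) addbF.
    by lia.
  - have -> : drop y.+1 w = drop (y - k).+1 (drop k w).
      by rewrite drop_drop; congr drop; lia.
    by rewrite dE drop_alt_word /= (negbTE oy) addbT.
  - by move=> i; rewrite !inE => /orP[/eqP-> //|/Ck ik]; lia.
have kn : (k <= n)%N by lia.
split=> j lE CE dE.
  have bE : b = b (+) odd m.+1.*2 by rewrite odd_double addbF.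
  rewrite (step _ _ _ CE bE dE) // r_alt // block_seriesE.
  rewrite fpsD fpsCM iter_fps_shift add0n fpsXM /P /alt_moments lE; congr (_ + _).
  (* The letter added at distance 2i leaves 2(j - 1 - i) + 1 unread positions. For j = 0 no letter
     can be added, so the value of [j.-1] is harmless. *)
  under eq_bigr => y yI.
    rewrite (_ : (_ * _) = if odd (y - k) then 0 else
      P b (y - k)./2 * (P (~~ b) * block_series b m.+2) (j.-1 - (y - k)./2)%N).
      over.
    case: ifP => oy; first by rewrite mulr0.
    have /andP[ky yn] : (k <= y < n)%N by rewrite inE in yI.
    have [sE drE lt] := next _ _ y (isT : (0 < m.+1.*2)%N) CE bE dE yI (negbT oy).
    congr (_ * _).
      rewrite /P /alt_moments; congr (word_sum (alt_word _ _)).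
      by rewrite -[LHS]odd_double_half oy.
    have lt' : (l - (y - k).+1 < N)%N by lia.
    have [_ H] := IH _ lt' (y |: C) y.+1 b m.+1 ltac:(lia) lt.
    apply: H => //.
    have := odd_double_half (y - k); rewrite oy add0n => <-; lia.
  rewrite (big_interval (fun i => if odd i then 0 else
    P b i./2 * (P (~~ b) * block_series b m.+2) (j.-1 - i./2)%N)) //.
  rewrite (_ : n - k = j.*2)%N; last by lia.
  rewrite (sum_even (fun i => P b i * (P (~~ b) * block_series b m.+2) (j.-1 - i)%N)).
  by case: (j) => [|j'] /=; rewrite ?big_ord0 //.
have bE : ~~ b = b (+) odd m.*2.+1 by rewrite /= odd_double addbT.
(* A block with an odd number of letters cannot be complete: the first term of the recursion
   vanishes. *)
rewrite (step _ _ _ CE bE dE) // r_odd_alt_word /= ?odd_double // mul0r add0r.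
under eq_bigr => y yI.
  rewrite (_ : (_ * _) = if odd (y - k) then 0 else
    P (~~ b) (y - k)./2 * block_series b m.+1 (j - (y - k)./2)%N).
    over.
  case: ifP => oy; first by rewrite mulr0.
  have /andP[ky yn] : (k <= y < n)%N by rewrite inE in yI.
  have [sE drE lt] := next _ _ y (isT : (0 < m.*2.+1)%N) CE bE dE yI (negbT oy).
  congr (_ * _).
    rewrite /P /alt_moments; congr (word_sum (alt_word _ _)).
    by rewrite -[LHS]odd_double_half oy.
  have lt' : (l - (y - k).+1 < N)%N by lia.
  have [H _] := IH _ lt' (y |: C) y.+1 b m ltac:(lia) lt.
  apply: H => //; last by rewrite negbK in drE.
  have := odd_double_half (y - k); rewrite oy add0n => <-; lia.
rewrite (big_interval (fun i => if odd i then 0 else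
  P (~~ b) i./2 * block_series b m.+1 (j - i./2)%N)) //.
rewrite (_ : n - k = j.*2.+1)%N; last by lia.
by rewrite (sum_even_odd (fun i => P (~~ b) i * block_series b m.+1 (j - i)%N)).
Qed.

End Blocks.

(** The block of the first letter starts with one letter read and 2j + 1 unread, which is the odd
    case with [m] = 0. It gives z [P (~~ b)] times [block_series b 1], and this is alpha_b(D)
    because [alpha b] has no constant term. *)
Lemma alt_moments_fixpoint b : P b = 1 + fps_comp (alpha b) D.
Proof.
rewrite fps_comp_rec // alpha0 (_ : fpsC 0 = 0); last by apply/funext => -[].
rewrite add0r {1}(DE b).
rewrite (_ : _ * _ = fpsX K * (P (~~ b) * block_series b 1)); last first.
  by rewrite /block_series /=; ring.
apply/funext => -[|j]; first by rewrite fpsD fpsXM /= addr0; exact: word_sum_nil.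
rewrite fpsD fpsXM /= fps1 add0r {1}/P /alt_moments doubleS.
set w := alt_word b _.
have sw : size w = (1 + j.*2.+1)%N by rewrite size_alt_word.
have w0 : (0 < size w)%N by rewrite sw.
pose x0 := Ordinal w0.
have -> : word_sum w = NC_sum_block (fun B : {set 'I_(size w)} => r (subword B))
    [set x0] (interval (size w) 1 (size w)).
  rewrite -NC_sum_min; last by move=> a; rewrite inE => /andP[].
  congr NC_sum; apply/setP => i; rewrite !inE -val_eqE /= ltn_ord andbT.
  by case: (nat_of_ord i).
have x0_lt (i : 'I_(size w)) : i \in [set x0] -> (i < 1)%N.
  by rewrite inE => /eqP->.
have [_ H] := NC_sum_block_alt_word b 0 sw x0_lt.
rewrite (H j) ?drop0 //.
by rewrite /subword enum_set1 /= (tnth_nth false).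
Qed.

End Words.

End NoncrossingPartitions.

(** * Series over an algebra with a linear functional *)

Section FreeProduct.
Variables (K : comNzRingType) (A : algType K) (phi : {scalar A}).

(** Scalar series become central elements of the series over [A], and the coefficientwise extension
    of [phi] is linear over them, so they behave like numbers in the freeness argument. *)
Definition iota_fps (s : fps K) : fps A := fun n => (s n)%:A.
Definition phi_fps (f : fps A) : fps K := fun n => phi (f n).

Local Notation io := iota_fps.
Local Notation Phi := phi_fps.

Lemma iota_fpsM s t : io (s * t) = io s * io t.
Proof.
apply/funext => n; rewrite /io !fpsM scaler_suml; apply: eq_bigr => i _.
by rewrite -scalerAl mul1r scalerA.
Qed.

Lemma iota_fpsB s t : io (s - t) = io s - io t.
Proof. by apply/funext => n; rewrite /io fpsD fpsN scalerBl. Qed.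

Lemma iota_fps1 : io 1 = 1.
Proof.
by apply/funext => n; rewrite /io !fps1; case: eqP; rewrite ?scale1r ?scale0r.
Qed.

Lemma iota_fpsC s (f : fps A) : io s * f = f * io s.
Proof.
apply/funext => n; rewrite !fpsM [RHS](reindex_inj rev_ord_inj) /=.
apply: eq_bigr => i _; rewrite subSS subKn; last by rewrite -ltnS.
by rewrite /io -scalerAl -scalerAr mul1r mulr1.
Qed.

Lemma phi_fpsZ s f : Phi (io s * f) = s * Phi f.
Proof.
apply/funext => n; rewrite /Phi !fpsM linear_sum; apply: eq_bigr => i _.
by rewrite /io -scalerAl mul1r scalarZ.
Qed.

Lemma phi_fpsD f g : Phi (f + g) = Phi f + Phi g.
Proof. by apply/funext => n; rewrite /Phi fpsD linearD. Qed.

Lemma phi_fpsB f g : Phi (f - g) = Phi f - Phi g.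
Proof. by apply/funext => n; rewrite /Phi !fpsD !fpsN linearB. Qed.

(** The inverse of 1 - s x, as the geometric series of the powers of s x. *)
Definition resolvent (s : fps K) (x : A) : fps A := fps_comp (fun k => x ^+ k) (io s).

Definition moments (x : A) : fps K := fun k => phi (x ^+ k).

Section Resolvent.
Variables (s : fps K) (x : A).
Hypothesis s0 : s 0%N = 0.

Let io0 : io s 0%N = 0. Proof. by rewrite /io s0 scale0r. Qed.

Lemma iota_fpsX k : io s ^+ k = io (s ^+ k).
Proof. by elim: k => [|k IH]; rewrite ?iota_fps1 // !exprS iota_fpsM IH. Qed.

Lemma resolvent_coef n : resolvent s x n = \sum_(k < n.+1) (s ^+ k) n *: x ^+ k.
Proof.
rewrite /resolvent (fps_comp_trunc _ io0 (ltnSn n)); apply: eq_bigr => k _.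
by rewrite iota_fpsX /io -scalerAr mulr1.
Qed.

Lemma phi_resolvent : Phi (resolvent s x) = fps_comp (moments x) s.
Proof.
apply/funext => n; rewrite /Phi resolvent_coef linear_sum.
rewrite (fps_comp_trunc _ s0 (ltnSn n)); apply: eq_bigr => k _.
by rewrite scalarZ mulrC.
Qed.

Lemma phi_mul_resolvent :
  Phi (fpsC x * resolvent s x) = fps_comp (fps_shift (moments x)) s.
Proof.
apply/funext => n; rewrite /Phi fpsCM resolvent_coef mulr_sumr linear_sum.
rewrite (fps_comp_trunc _ s0 (ltnSn n)); apply: eq_bigr => k _.
by rewrite -scalerAr scalarZ mulrC -exprS.
Qed.

Lemma resolventE : resolvent s x = 1 + io s * fpsC x * resolvent s x.
Proof.
rewrite {1}/resolvent fps_compE //; congr (_ + _).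
  by apply/funext => n; rewrite fps1 /fpsC; case: eqP.
rewrite -iota_fpsC -mulrA; congr (_ * _); apply/funext => n.
rewrite fpsCM /resolvent /fps_comp /ser_comp mulr_sumr.
by apply: eq_bigr => k _; rewrite mulrA -exprS.
Qed.

Lemma mul_resolvent_comm : fpsC x * resolvent s x = resolvent s x * fpsC x.
Proof.
apply/funext => n; rewrite fpsCM fpsMC resolvent_coef mulr_sumr mulr_suml.
by apply: eq_bigr => k _; rewrite -scalerAr -scalerAl -exprS -exprSr.
Qed.

Lemma mul_resolvent : (1 - io s * fpsC x) * resolvent s x = 1.
Proof. by rewrite mulrBl mul1r {1}resolventE addrK. Qed.

Lemma resolvent_mul : resolvent s x * (1 - io s * fpsC x) = 1.
Proof.
rewrite -[RHS]mul_resolvent mulrBr mulrBl mul1r mulr1; congr (_ - _).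
by rewrite mulrA -iota_fpsC -!mulrA mul_resolvent_comm.
Qed.

End Resolvent.

Definition fps_over (B : set A) (f : fps A) := forall n, B (f n).

Section Over.
Variable x : A.
Local Notation B := (range (horner_alg x : {poly K} -> A)).

Lemma over_iota s : fps_over B (io s).
Proof. by move=> n; exists (s n)%:P; rewrite // horner_algC. Qed.

Lemma over_const : fps_over B (fpsC x).
Proof.
move=> [|n]; first by exists 'X; rewrite // horner_algX.
by exists 0; rewrite // rmorph0.
Qed.

Lemma overB f g : fps_over B f -> fps_over B g -> fps_over B (f - g).
Proof.
move=> fB gB n; have [p _ pE] := fB n; have [q _ qE] := gB n.
by exists (p - q); rewrite // rmorphB /= pE qE.
Qed.

Lemma overM f g : fps_over B f -> fps_over B g -> fps_over B (f * g).
Proof.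
move=> fB gB n; rewrite fpsM.
elim/big_ind: _ => [|_ _ [p _ <-] [q _ <-]|i _].
- by exists 0; rewrite // rmorph0.
- by exists (p + q); rewrite // rmorphD.
- have [p _ pE] := fB i; have [q _ qE] := gB (n - i)%N.
  by exists (p * q); rewrite // rmorphM /= pE qE.
Qed.

Lemma over_resolvent (s : fps K) : s 0%N = 0 -> fps_over B (resolvent s x).
Proof.
move=> s0 n; exists (\sum_(k < n.+1) (s ^+ k) n *: 'X^k) => //.
rewrite resolvent_coef // linear_sum; apply: eq_bigr => k _.
by rewrite linearZ /= rmorphXn /= horner_algX mulr_algl.
Qed.

End Over.

Section Freeness.
Variable B : bool -> set A.
Hypothesis free : forall (n : nat) (i : nat -> bool) (x : nat -> A),
  (forall k, (k < n)%N -> i k != i k.+1) ->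
  (forall k, (k <= n)%N -> B (i k) (x k) /\ phi (x k) = 0) ->
  phi (\prod_(0 <= k < n.+1) x k) = 0.

Local Notation alternate := (sorted (fun b c : bool => b != c)).

Lemma free_prod_seq (l : seq (bool * A)) : l != [::] ->
  alternate (map fst l) -> (forall p, p \in l -> B p.1 p.2 /\ phi p.2 = 0) ->
  phi (\prod_(p <- l) p.2) = 0.
Proof.
case: l => // p0 l _ lalt lB; rewrite (big_nth p0) /=.
apply: (@free (size l) (fun k => (nth p0 (p0 :: l) k).1)
                       (fun k => (nth p0 (p0 :: l) k).2)) => k kl.
  have := sortedP p0.1 lalt; rewrite size_map.
  move/(_ k) => /=; rewrite ltnS => /(_ kl).
  rewrite -(nth_map p0 p0.1 fst (s := p0 :: l)) ?ltnS; last exact: ltnW.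
  by rewrite -(nth_map p0 p0.1 fst (s := l)).
by apply: lB; apply: mem_nth; rewrite ltnS.
Qed.

(** Freeness concerns elements, whereas the factorization yields series. The induction expands one
    series factor at a time: each coefficient of a centred series is centred and joins [l]. The
    first hypothesis says that [l] and [s] are not both empty. *)
Lemma free_prod_mixed (l : seq (bool * A)) (s : seq (bool * fps A)) n :
  l ++ map (fun p => (p.1, 0)) s != [::] ->
  alternate (map fst l ++ map fst s) ->
  (forall p, p \in l -> B p.1 p.2 /\ phi p.2 = 0) ->
  (forall p, p \in s -> fps_over (B p.1) p.2 /\ Phi p.2 = 0) ->
  phi (\prod_(p <- l) p.2 * (\prod_(p <- s) p.2) n) = 0.
Proof.
elim: s l n => [|[i f] s IH] l n; rewrite ?cats0 /=.
  move=> l0 lalt lB _; rewrite big_nil fps1.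
  by case: eqP => _; rewrite ?mulr1 ?mulr0 ?raddf0 // free_prod_seq.
move=> _ alt lB sB; have [fB f0] := sB (i, f) (mem_head _ _).
rewrite big_cons fpsM mulr_sumr linear_sum big1 // => k _ /=.
rewrite mulrA.
have -> : \prod_(p <- l) p.2 * f k = \prod_(p <- rcons l (i, f k)) p.2.
  by rewrite -cats1 big_cat /= big_seq1.
apply: IH.
- by case: (l).
- by rewrite map_rcons cat_rcons.
- move=> p; rewrite mem_rcons inE => /orP[/eqP->|/lB //] /=.
  by split=> //; apply: (congr1 (@^~ (nat_of_ord k)) f0).
- by move=> p ps; apply: sB; rewrite inE ps orbT.
Qed.

Lemma free_prod_fps (s : seq (bool * fps A)) : s != [::] ->
  alternate (map fst s) ->
  (forall p, p \in s -> fps_over (B p.1) p.2 /\ Phi p.2 = 0) ->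
  Phi (\prod_(p <- s) p.2) = 0.
Proof.
move=> s0 salt sB; apply/funext => n; rewrite /Phi.
have := @free_prod_mixed [::] s n; rewrite big_nil mul1r; apply=> //=.
by case: (s) s0.
Qed.

End Freeness.

Lemma sorted_alt_word b k :
  sorted (fun b c : bool => b != c) (alt_word b k).
Proof.
elim: k b => // -[//|k] IH b /=.
by have /= := IH (~~ b); rewrite negbK => ->; case: (b).
Qed.

Section CompoundPoisson.
Variables a b : A.
Hypothesis phi1 : phi 1 = 1.
Hypothesis free : forall (n : nat) (i : nat -> bool) (x : nat -> A),
  (forall k, (k < n)%N -> i k != i k.+1) ->
  (forall k, (k <= n)%N ->
     range (horner_alg (if i k then b else a) : {poly K} -> A) (x k) /\
     phi (x k) = 0) ->
  phi (\prod_(0 <= k < n.+1) x k) = 0.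
Hypothesis catalan : moments b = 1 + fpsX K * (moments b * moments b).

Local Notation Ca := (fpsC a).
Local Notation Cb := (fpsC b).

(** The factorization of 1 - z a b becomes an identity in the span of 1, a, b and a b over scalar
    series; comparing the four coordinates leaves commutative identities for [ring]. *)
Let lin (p q r s : fps K) : fps A :=
  io p + io q * Ca + io r * Cb + io s * (Ca * Cb).

Let linM (p q r s : fps K) :
  (io p + io q * Ca) * (io r + io s * Cb) = lin (p * r) (q * r) (p * s) (q * s).
Proof.
have e1 : io p * (io s * Cb) = io (p * s) * Cb by rewrite iota_fpsM mulrA.
have e2 : io q * Ca * io r = io (q * r) * Ca.
  by rewrite -mulrA -iota_fpsC mulrA -iota_fpsM.
have e3 : io q * Ca * (io s * Cb) = io (q * s) * (Ca * Cb).
  by rewrite -mulrA [Ca * _]mulrA -iota_fpsC -mulrA mulrA -iota_fpsM.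
rewrite /lin mulrDl !mulrDr e1 e2 e3 -iota_fpsM !addrA.
by rewrite [_ + _ + io (q * r) * _]addrAC.
Qed.

Let linZ (c p q r s : fps K) : io c * lin p q r s = lin (c * p) (c * q) (c * r) (c * s).
Proof. by rewrite /lin !mulrDr !mulrA -!iota_fpsM. Qed.

Let linB (p q r s p' q' r' s' : fps K) :
  lin p q r s - lin p' q' r' s' = lin (p - p') (q - q') (r - r') (s - s').
Proof.
rewrite /lin !iota_fpsB !mulrBl !opprD.
by rewrite [LHS](AC (4*4) ((1*5)*(2*6)*(3*7)*(4*8))).
Qed.

Let expand (x y z : fps A) (s : fps K) :
  (x + io s) * (y * (z + io s)) =
  x * y * z + io s * (x * y) + io s * (y * z) + io s * (io s * y).
Proof.
rewrite [y * _]mulrDr [LHS]mulrDl !mulrDr -[y * io s]iota_fpsC !addrA.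
by rewrite !mulrA -[x * io s]iota_fpsC.
Qed.

Lemma phi_fps1 : Phi 1 = 1.
Proof.
by apply/funext => n; rewrite /Phi !fps1; case: eqP; rewrite ?phi1 ?linear0.
Qed.

Lemma phi_iota s : Phi (io s) = s.
Proof. by rewrite -[io s]mulr1 phi_fpsZ phi_fps1 mulr1. Qed.

(* With u = z c, v = (1 - 1/c)/c and psi_a(u) = psi_b(v) = c, the factorization
   1 - z a b = c (1 - u a) (1 - a' b') (1 - v b), where a' = 1 - (1 - u a)^-1 / c
   and b' = (1 - b/c) (1 - v b)^-1 are centred, reduces phi((1 - z a b)^-1) to
   alt_word products of centred elements (Haagerup's trick). *)
Lemma free_product_moments (c : fps K) :
  c = fps_comp (moments a) (fpsX K * c) -> moments (a * b) = c.
Proof.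
move=> cE; pose u : fps K := fpsX K * c.
have u0 : u 0%N = 0 by rewrite /u fpsM0 fpsX0 mul0r.
have c0 : c 0%N = 1 by rewrite cE fps_comp0E // /moments expr0 phi1.
have [ci cci] : exists ci, c * ci = 1.
  exists (fps_comp (fun=> 1) (1 - c)).
  have d0 : (1 - c : fps K) 0%N = 0 by rewrite fpsD fpsN c0 fps1 subrr.
  set g := fps_comp _ _; have gE : g = 1 + (1 - c) * g.
    rewrite {1}/g fps_comp_rec //; congr (_ + _).
    by apply/funext => n; rewrite fps1 /fpsC; case: eqP.
  by rewrite -[c](subKr 1) mulrBl mul1r {1}gE addrK.
have ci0 : ci 0%N = 1.
  by have := congr1 (@^~ 0%N) cci; rewrite fpsM0 c0 mul1r.
(* This value is forced: if psi_b(v) = c, the Catalan equation reads c = 1 + v c^2. *)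
pose v : fps K := (1 - ci) * ci.
have v0 : v 0%N = 0 by rewrite /v fpsM0 fpsD fpsN ci0 fps1 subrr mul0r.
have vcc : v * (c * c) = c - 1.
  by rewrite /v; ring: cci.
(* Both sides solve x = 1 + v x^2, which has only one solution because v has no constant term. *)
have psib : fps_comp (moments b) v = c.
  apply: agreeP => n; elim: n => // n IH.
  rewrite catalan fps_compD fps_compXM // fps_compM //.
  have -> : fps_comp 1 v = 1.
    by have -> : (1 : fps K) = fpsC 1 by [apply/funext => -[]]; rewrite fps_compC.
  rewrite [X in agree _ _ X](_ : c = 1 + v * (c * c)); last by rewrite vcc; ring.
  by apply: agreeD => //; apply: agree_mulS => //; apply: agreeM.
have psib' : fps_comp (fps_shift (moments b)) v = c * c.
  have -> : fps_shift (moments b) = moments b * moments b.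
    by apply/funext => n; rewrite /fps_shift {1}catalan fpsD fps1 add0r fpsXM.
  by rewrite fps_compM // psib.
pose U : fps A := resolvent u a; pose V : fps A := resolvent v b.
(* The centred series 1 - V/c equals (1 - 1/c) (1 - b/c) V. The scalar 1 - 1/c has no constant term
   and is not invertible, so [B'] is defined as the remaining factor, and its centring is checked
   separately. *)
pose A' : fps A := 1 - io ci * U; pose B' : fps A := (1 - io ci * Cb) * V.
have PU : Phi U = c by rewrite phi_resolvent // -cE.
have PV : Phi V = c by rewrite phi_resolvent.
have PA : Phi A' = 0 by rewrite phi_fpsB phi_fps1 phi_fpsZ PU mulrC cci subrr.
have PB : Phi B' = 0.
  rewrite /B' mulrBl mul1r phi_fpsB PV -mulrA phi_fpsZ phi_mul_resolvent // psib'.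
  by rewrite mulrA [ci * c]mulrC cci mul1r subrr.
pose E : fps A := A' * B'.
(* [U] and 1/c both have constant term 1, so [A'] has none. Hence [E ^+ k] has order at least k, and
   1 - E is inverted by its geometric series. *)
have E0 : E 0%N = 0.
  have U0 : U 0%N = 1.
    by rewrite /U resolventE // fpsD fps1 -mulrA fpsM0 /io u0 scale0r mul0r addr0.
  have A0 : A' 0%N = 0.
    by rewrite /A' fpsD fpsN fps1 fpsM0 U0 mulr1 /io ci0 scale1r subrr.
  by rewrite /E fpsM0 A0 mul0r.
pose W : fps A := fun n => (a * b) ^+ n.
have WE : (1 - io (fpsX K) * (Ca * Cb)) * W = 1.
  apply/eqP; rewrite mulrBl mul1r subr_eq; apply/eqP/funext => n.
  have ioX : io (fpsX K) = fpsX A.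
    by apply/funext => k; rewrite /io /fpsX; case: eqP; rewrite ?scale1r ?scale0r.
  rewrite fpsD fps1 -mulrA ioX fpsXM; case: n => [|n] /=; first by rewrite addr0.
  by rewrite add0r -mulrA !fpsCM mulrA -exprS.
(* The factorization amounts to c W = V (1 - E)^-1 U, and [w] is the part (1 - E)^-1 U. *)
pose w : fps A := (1 - io v * Cb) * (io c * W).
have wE : w = U + E * w.
  have key : io c * ((1 - io u * Ca) * (1 - E) * (1 - io v * Cb)) =
             1 - io (fpsX K) * (Ca * Cb).
    have E1 : (1 - io u * Ca) * A' = io (1 - ci) - io u * Ca.
      rewrite mulrBr mulr1 mulrA -[_ * io ci]iota_fpsC -mulrA mul_resolvent //.
      by rewrite mulr1 iota_fpsB iota_fps1 addrAC.
    have E2 : B' * (1 - io v * Cb) = 1 - io ci * Cb.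
      by rewrite -mulrA resolvent_mul // mulr1.
    have -> : (1 - io u * Ca) * (1 - E) * (1 - io v * Cb) =
        (1 - io u * Ca) * (1 - io v * Cb) -
        (io (1 - ci) - io u * Ca) * (1 - io ci * Cb).
      rewrite [(1 - io u * Ca) * (1 - E)]mulrBr mulr1 [LHS]mulrBl /E mulrA E1.
      congr (_ - _).
      by rewrite -mulrA E2.
    have ioN (s : fps K) x : - (io s * x) = io (- s) * x.
      by rewrite -mulNr -[in RHS]sub0r iota_fpsB -[0 in RHS](subrr 1) iota_fpsB
                 subrr sub0r.
    rewrite !ioN -iota_fps1 !linM linB linZ.
    transitivity (lin 1 0 0 (- fpsX K)).
      by congr lin; rewrite ?/u ?/v; ring: cci.
    have io0 : io 0 = 0 by rewrite -(subrr 1) iota_fpsB subrr.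
    by rewrite /lin io0 !mul0r !addr0.
  have e1 : (1 - io u * Ca) * ((1 - E) * w) = 1.
    rewrite -[RHS]WE -key /w -[RHS]mulrA [RHS]iota_fpsC -!mulrA.
    by rewrite -[W * io c]iota_fpsC.
  apply/eqP; rewrite -subr_eq -{1}[w]mul1r -mulrBl; apply/eqP.
  by have := congr1 ( *%R U) e1; rewrite mulr1 [LHS]mulrA [U * _]resolvent_mul // mul1r.
have wN N : w = \sum_(k < N) E ^+ k * U + E ^+ N * w.
  elim: N => [|N IH]; first by rewrite big_ord0 add0r mul1r.
  rewrite {1}IH big_ord_recr /= -addrA; congr (_ + _).
  by rewrite {1}wE mulrDr mulrA exprSr.
have oU : fps_over (range (horner_alg a : {poly K} -> A)) U by apply: over_resolvent.
have oV : fps_over (range (horner_alg b : {poly K} -> A)) V by apply: over_resolvent.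
have oA : fps_over (range (horner_alg a : {poly K} -> A)) A'.
  by rewrite /A' -iota_fps1; apply: overB (over_iota _ _) (overM (over_iota _ _) oU).
have oB : fps_over (range (horner_alg b : {poly K} -> A)) B'.
  rewrite /B' -iota_fps1; apply: overM oV; apply: overB (over_iota _ _) _.
  exact: overM (over_iota _ _) (over_const _).
pose bl : seq (bool * fps A) := [:: (false, A'); (true, B')].
pose U0 : fps A := U - io c; pose V0 : fps A := V - io c.
have oU0 : fps_over (range (horner_alg a : {poly K} -> A)) U0.
  exact: overB oU (over_iota _ _).
have oV0 : fps_over (range (horner_alg b : {poly K} -> A)) V0.
  exact: overB oV (over_iota _ _).
have PU0 : Phi U0 = 0 by rewrite phi_fpsB PU phi_iota subrr.
have PV0 : Phi V0 = 0 by rewrite phi_fpsB PV phi_iota subrr.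
pose good (p : bool * fps A) :=
  fps_over (range (horner_alg (if p.1 then b else a) : {poly K} -> A)) p.2 /\
  Phi p.2 = 0.
have blE k : \prod_(p <- flatten (nseq k bl)) p.2 = E ^+ k.
  elim: k => [|k IH]; first by rewrite big_nil.
  by rewrite /= !big_cons /= IH exprS mulrA.
have blF k : map fst (flatten (nseq k bl)) = alt_word false k.*2.
  by elim: k => //= k ->.
have rcF k : rcons (alt_word false k.*2) false = alt_word false k.*2.+1.
  by rewrite -rcons_alt_word odd_double.
have blG k p : p \in flatten (nseq k bl) -> good p.
  by elim: k => //= k IH; rewrite !inE => /or3P[/eqP->|/eqP->|].
have alt0 (l : seq (bool * fps A)) d k : map fst l = alt_word d k.+1 ->
    (forall p, p \in l -> good p) -> Phi (\prod_(p <- l) p.2) = 0.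
  pose B (i : bool) := range (horner_alg (if i then b else a) : {poly K} -> A).
  move=> lE lG; apply: (@free_prod_fps B free) => //.
    by apply: contra_eq_neq lE => ->.
  by rewrite lE sorted_alt_word.
(* With V = V0 + c and U = U0 + c, every product containing [V0] or [U0] alternates between [b] and
   [a] with centred factors, also for k = 0. What is left is c^2 Phi(E^k), which vanishes for k > 0
   for the same reason. *)
have term k : Phi (V * (E ^+ k * U)) = if k == 0%N then c * c else 0.
  rewrite -[V](subrK (io c)) -[U](subrK (io c)) -/V0 -/U0 expand.
  rewrite !phi_fpsD !phi_fpsZ.
  have -> : Phi (V0 * E ^+ k * U0) = 0.
    have := alt0 ((true, V0) :: rcons (flatten (nseq k bl)) (false, U0)) true k.*2.+1.
    rewrite big_cons -cats1 big_cat /= big_seq1 blE mulrA; apply.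
      by rewrite /= map_cat blF cats1 rcF.
    move=> p; rewrite inE mem_cat inE => /or3P[/eqP->//|/blG //|/eqP->//].
  have -> : Phi (V0 * E ^+ k) = 0.
    have := alt0 ((true, V0) :: flatten (nseq k bl)) true k.*2.
    rewrite big_cons blE; apply; first by rewrite /= blF.
    by move=> p; rewrite inE => /orP[/eqP->//|/blG].
  have -> : Phi (E ^+ k * U0) = 0.
    have := alt0 (rcons (flatten (nseq k bl)) (false, U0)) false k.*2.
    rewrite -cats1 big_cat /= big_seq1 blE; apply.
      by rewrite map_cat blF cats1 rcF.
    by move=> p; rewrite mem_cat inE => /orP[/blG|/eqP->].
  rewrite !mulr0 !add0r; case: k => [|k]; first by rewrite expr0 phi_fps1 mulr1.
  have -> : Phi (E ^+ k.+1) = 0.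
    have := alt0 (flatten (nseq k.+1 bl)) false k.*2.+1.
    by rewrite blE; apply; [rewrite blF doubleS|exact: blG].
  by rewrite !mulr0.
have VW : io c * W = V * w.
  by rewrite mulrA resolvent_mul // mul1r.
(* Only the term k = 0 of the geometric series contributes, and the remainder of order n + 1 does
   not reach coefficient [n]. *)
have cW : c * moments (a * b) = c * c.
  have -> : c * moments (a * b) = Phi (V * w) by rewrite -VW phi_fpsZ.
  apply/funext => n; rewrite (wN n.+1) mulrDr phi_fpsD fpsD mulr_sumr.
  have -> : Phi (V * (E ^+ n.+1 * w)) n = 0.
    have /(_ n (ltnSn n)) E_n : agree n.+1 (V * (E ^+ n.+1 * w)) 0.
      rewrite -[X in agree _ _ X](mulr0 V); apply: agreeM => //.
      rewrite -[X in agree _ _ X](mul0r w); apply: agreeM => //.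
      by move=> i iN; rewrite fps_exp_lt.
    by rewrite /Phi E_n linear0.
  rewrite addr0 /Phi fps_sum linear_sum big_ord_recl /= big1 ?addr0.
    by have := congr1 (fun f : fps K => f n) (term 0%N).
  by move=> k _; have := congr1 (fun f : fps K => f n) (term k.+1).
by rewrite -[LHS]mul1r -cci mulrAC cW -mulrA cci mulr1.
Qed.

End CompoundPoisson.

End FreeProduct.

(** * Moments of the Marchenko-Pastur distribution *)

Section MarchenkoPastur.
Local Open Scope classical_set_scope.
Context (R : realType).
Local Notation mu := (@lebesgue_measure R).

(** For x >= 0 the power is the inverse of x; in this form measurability on the whole line follows
    from that of power functions. *)
Definition mp_density (x : R) : R :=
  (2 * pi)^-1 * Num.sqrt ((4 - x) * x `^ (-1)).

Lemma mp_densityE x : 0 <= x ->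
  mp_density x = (2 * pi)^-1 * Num.sqrt ((4 - x) / x).
Proof. by move=> x0; rewrite /mp_density powR_inv1. Qed.

Lemma measurable_mp_density : measurable_fun [set: R] mp_density.
Proof.
apply: measurable_funM => //.
apply: (measurableT_comp (continuous_measurable_fun (@sqrt_continuous R))).
apply: measurable_funM; first exact: measurable_funB.
exact: measurable_powR.
Qed.

Definition mp_factor n (x : R) : R := (4 * n + 2)%:R * x ^+ n - n.+2%:R * x ^+ n.+1.

(** This is x^(n+1) (4 - x) times the density. It vanishes at 0 and at 4, and its derivative is
    [mp_factor n] times the density; so the integral of [mp_factor n] is zero, which is the
    recursion of the Catalan numbers. *)
Definition mp_primitive n (x : R) : R :=
  (2 * pi)^-1 * (x ^+ n * (Num.sqrt x * ((4 - x) * Num.sqrt (4 - x)))).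

Lemma continuous_mp_primitive n : continuous (mp_primitive n).
Proof.
move=> x; apply: cvgM; first exact: cvg_cst.
apply: cvgM; first exact: exprn_continuous.
apply: cvgM; first exact: sqrt_continuous.
have c4 : (4 - y @[y --> x] --> 4 - x) by apply: cvgB; [exact: cvg_cst|exact: cvg_id].
apply: cvgM => //.
exact: (continuous_comp c4 (@sqrt_continuous _ _)).
Qed.

Lemma is_derive_mp_primitive n (x : R) : 0 < x -> x < 4 ->
  is_derive x 1 (mp_primitive n) (mp_factor n x * mp_density x).
Proof.
move=> x0 x4; rewrite mp_densityE ?ltW //.
have y0 : 0 < 4 - x by rewrite subr_gt0.
have s0 : Num.sqrt x != 0 by rewrite gt_eqF // sqrtr_gt0.
have q0 : Num.sqrt (4 - x) != 0 by rewrite gt_eqF // sqrtr_gt0.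
have d1 : is_derive x 1 (fun y : R => 4 - y) (-1).
  by apply: is_derive_eq; rewrite add0r mul1r.
have dq : is_derive x 1 (fun y : R => Num.sqrt (4 - y))
    ((2 * Num.sqrt (4 - x))^-1 * -1).
  by apply: (is_derive1_comp (g := fun y : R => 4 - y)); exact: is_derive1_sqrt.
have dn : is_derive x 1 (fun y : R => y ^+ n) (n%:R * (x ^+ n / x)).
  split; [exact: exprn_derivable|rewrite exp_derive [LHS]mulr1 -[_ *: _]/(_ * _)].
  by case: n => [|n]; rewrite ?mul0r // exprSr mulfK ?gt_eqF.
set q := Num.sqrt (4 - x) in q0 dq *; set s := Num.sqrt x in s0 *.
have D : is_derive x 1 (mp_primitive n) ((2 * pi)^-1 *
    (x ^+ n * (s * ((4 - x) * ((2 * q)^-1 * -1) + q * -1) +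
               (4 - x) * q * (2 * s)^-1) +
     s * ((4 - x) * q) * (n%:R * (x ^+ n / x))) +
    x ^+ n * (s * ((4 - x) * q)) * 0).
  exact: is_deriveM (is_derive_cst ((2 * pi)^-1 : R) x 1)
    (is_deriveM dn (is_deriveM (is_derive1_sqrt x0) (is_deriveM d1 dq))).
apply: (is_derive_eq D); rewrite /mp_factor exprS.
have -> : Num.sqrt ((4 - x) / x) = q / s by rewrite sqrtrM ?sqrtrV ?ltW.
have qE : q ^+ 2 = 4 - x by rewrite sqr_sqrtr ?ltW.
have sE : s ^+ 2 = x by rewrite sqr_sqrtr ?ltW.
(* The right-hand side displays the logarithmic derivative (n + 1/2)/x - (3/2)/(4 - x) of the
   primitive, with s^2 = x and q^2 = 4 - x. *)
have -> : (4 * n + 2)%:R * x ^+ n - n.+2%:R * (x * x ^+ n) =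
    x ^+ n * ((n%:R + 2^-1) * q ^+ 2 - 3 / 2 * s ^+ 2).
  by rewrite qE sE natrD natrM -natr1 -natr1; field.
have : (pi : R) != 0 by rewrite gt_eqF ?pi_gt0.
rewrite -qE; move: (x ^+ n) (pi : R) => X P P0; rewrite -sE; field.
by rewrite s0 q0 P0.
Qed.

(** The density is unbounded near 0, so the fundamental theorem is applied away from it; at the
    upper end the primitive vanishes. *)
Lemma mp_FTC n (e : R) : 0 < e -> e < 4 ->
  (\int[mu]_(x in `[e, 4%R]) (mp_factor n x * mp_density x)%:E =
   (- mp_primitive n e)%:E)%E.
Proof.
move=> e0 e4.
have -> : (- mp_primitive n e)%:E = ((mp_primitive n 4)%:E - (mp_primitive n e)%:E)%E.
  by rewrite /mp_primitive subrr mul0r !mulr0 sub0e EFinN.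
pose f (x : R) := mp_factor n x * ((2 * pi)^-1 * Num.sqrt ((4 - x) / x)).
rewrite -(@continuous_FTC2 _ f) //.
- apply: eq_integral => x; rewrite inE /= in_itv /= => /andP[ex _].
  by rewrite mp_densityE // (le_trans (ltW e0)).
- apply: continuous_in_subspaceT => x; rewrite inE /= in_itv /= => /andP[ex _].
  have x0 : x != 0 by rewrite gt_eqF // (lt_le_trans e0).
  apply: cvgM.
    apply: cvgB; apply: cvgM; first exact: cvg_cst.
    + exact: exprn_continuous.
    + exact: cvg_cst.
    + exact: exprn_continuous.
  apply: cvgM; first exact: cvg_cst.
  have c4 : ((4 - y) / y @[y --> x] --> (4 - x) / x).
    apply: cvgM; last exact: inv_continuous.
    by apply: cvgB; [exact: cvg_cst|exact: cvg_id].
  exact: (continuous_comp c4 (@sqrt_continuous _ _)).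
- split.
  + move=> x; rewrite in_itv /= => /andP[ex x4].
    by have [] := is_derive_mp_primitive n (lt_trans e0 ex) x4.
  + by apply: cvg_at_right_filter; exact: continuous_mp_primitive.
  + by apply: cvg_at_left_filter; exact: continuous_mp_primitive.
- move=> x; rewrite in_itv /= => /andP[ex x4].
  have [_] := is_derive_mp_primitive n (lt_trans e0 ex) x4.
  rewrite derive1E => ->; rewrite /f mp_densityE //.
  exact: ltW (lt_trans e0 ex).
Qed.

Variable p : borel_probability R.
Hypothesis pMP : is_Marchenko_Pastur p.

Lemma mp_probE (A : set R) : measurable A ->
  p A = (\int[mu]_(x in A `&` `[0%R, 4%R]) (mp_density x)%:E)%E.
Proof.
move=> mA; rewrite pMP //; apply: eq_integral => x; rewrite inE => -[_] /=.
by rewrite in_itv /= => /andP[x0 _]; rewrite mp_densityE.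
Qed.

Lemma mp_dominated : p `<< mu.
Proof.
apply/null_content_dominatesP => A mA A0; rewrite mp_probE //.
apply: null_set_integral.
- exact: measurableI.
- by apply/measurable_EFinP/measurable_funTS; exact: measurable_mp_density.
- by apply: (subset_measure0 _ mA) A0 => //; exact: measurableI.
Qed.

(** [p] is given by its values on sets. Its Radon-Nikodym derivative and the density have equal
    integrals over measurable subsets of [U], hence agree almost everywhere on [U]. *)
Lemma mp_integral (f : R -> \bar R) (U : set (measurableTypeR R)) :
  measurable U -> U `<=` `[0%R, 4%R] ->
  p.-integrable U f ->
  (\int[p]_(x in U) f x = \int[mu]_(x in U) (f x * (mp_density x)%:E))%E.
Proof.
move=> mU U04 fi; rewrite -(Radon_Nikodym_change_of_variables mp_dominated) //.
have mf := measurable_int _ fi.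
apply: ae_eq_integral => //.
- apply: emeasurable_funM => //; apply: (measurable_int mu).
  apply: (integrableS _ _ (@subsetT _ _)) => //=.
  by apply: Radon_Nikodym_integrable; exact: mp_dominated.
- apply: emeasurable_funM => //=; apply/measurableT_comp => //=.
  by apply/measurable_funTS; exact: measurable_mp_density.
- apply: ae_eqe_mul2l => /=.
  rewrite Radon_NikodymE //=; first exact: mp_dominated.
  move=> dom; case: cid => /= h [h1 h2 h3].
  apply: integral_ae_eq => //=.
  + exact: integrableS h2.
  + by apply/measurable_funTS/measurableT_comp => //; exact: measurable_mp_density.
  + move=> E EU mE; rewrite -h3 //= mp_probE // setIidl //.
    exact: subset_trans EU U04.
Qed.

Let I : set (measurableTypeR R) := `]0%R, 4%R].

Let mI : measurable I. Proof. exact: measurable_itv. Qed.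

Let pIC : p (~` I) = 0%E.
Proof.
rewrite mp_probE; last exact: measurableC.
apply: (integral_Sset1 0) => x [/= nI]; rewrite /I /= !in_itv /= => /andP[x0 x4].
apply/eqP; rewrite eq_le x0 andbT leNgt; apply/negP => x0'.
by apply: nI; rewrite /I /= in_itv /= x0' x4.
Qed.

Lemma mp_momentE n : moment p n = (\int[p]_(x in I) (x ^+ n))%R.
Proof.
rewrite /moment /Rintegral; congr fine.
rewrite [RHS]integral_mkcond; apply: ae_eq_integral => //.
- by apply/measurable_EFinP.
- apply/(measurable_restrictT _ mI); apply: measurable_funTS.
  by apply/measurable_EFinP.
- exists (~` I); split => //; first exact: measurableC.
  move=> x /= H Ix; apply: H => _; rewrite patchE ifT // inE.
  exact: Ix.
Qed.

Let mp_bound n (x : R) : x \in I -> `|x ^+ n| <= 4 ^+ n.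
Proof.
rewrite inE /I /= in_itv /= => /andP[x0 x4].
by rewrite ger0_norm ?exprn_ge0 ?lerXn2r ?nnegrE // ltW.
Qed.

Let integrableX n : p.-integrable I (EFin \o (fun x : R => x ^+ n)).
Proof.
apply: measurable_bounded_integrable => //.
- by rewrite (le_lt_trans (probability_le1 p mI)) // ltry.
- exists (4 ^+ n); split; first exact: num_real.
  move=> M ltM x Ix; apply: le_trans (ltW ltM); apply: mp_bound.
  by rewrite inE.
Qed.

(** The integrals over [1/(k+1), 4] are boundary values of the primitive and tend to 0. The factor
    is bounded on ]0, 4] and [p] is finite, so dominated convergence applies. *)
Let mp_factor_integral n : (\int[p]_(x in I) (mp_factor n x)%:E = 0)%E.
Proof.
pose e (k : nat) : R := k.+1%:R^-1.
have e0 k : 0 < e k by rewrite invr_gt0.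
have e1 k : e k <= 1 by rewrite invf_le1 // ler1n.
have e4 k : e k < 4 by apply: le_lt_trans (e1 k) _; rewrite ltr1n.
pose E k : set (measurableTypeR R) := `[e k, 4%R].
have EI k : E k `<=` I.
  move=> x; rewrite /E /I /= !in_itv /= => /andP[ex ->]; rewrite andbT.
  exact: lt_le_trans ex.
have mE k : measurable (E k) by exact: measurable_itv.
have mf : measurable_fun I (EFin \o mp_factor n).
  apply/measurable_EFinP; apply: measurable_funB;
  by apply: measurable_funM => //; exact: exprn_measurable.
pose B : R := (4 * n + 2)%:R * 4 ^+ n + n.+2%:R * 4 ^+ n.+1.
have fB x : x \in I -> `|mp_factor n x| <= B.
  move=> xI; apply: le_trans (ler_normB _ _) _; rewrite !normrM !normr_nat.
  by apply: lerD; apply: ler_wpM2l; rewrite ?ler0n ?mp_bound.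
have iB : p.-integrable I (EFin \o cst B).
  exact: finite_measure_integrable_cst.
have Ef k : (\int[p]_(x in I) ((EFin \o mp_factor n) \_ (E k)) x =
    (- mp_primitive n (e k))%:E)%E.
  rewrite -integral_mkcondr setIidr // mp_integral //.
  - under eq_integral do rewrite -EFinM.
    exact: mp_FTC.
  - apply: subset_trans (EI k) _; rewrite /I => x /=.
    by rewrite !in_itv /= => /andP[/ltW -> ->].
  - apply: (integrableS mI) => //; apply: le_integrable iB => //.
    move=> x Ix /=; rewrite lee_fin (le_trans (fB x _)) ?inE //.
    exact: ler_norm.
pose f_ k := (EFin \o mp_factor n) \_ (E k).
have h1 k : measurable_fun I (f_ k).
  apply: (measurable_funS measurableT) => //; apply/(measurable_restrictT _ (mE k)).
  exact: measurable_funS (EI k) mf.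
have h2 : \forall x \ae p, I x -> f_ ^~ x @ \oo --> (EFin \o mp_factor n) x.
  apply: aeW => x Ix; have /andP[x0 x4] : 0 < x <= 4 by move: Ix; rewrite /I /= in_itv.
  apply: cvg_near_cst; have [N _ HN] := near_infty_natSinv_lt (PosNum x0).
  exists N => // k /= Nk; rewrite /f_ patchE ifT // inE /E /= in_itv /= x4 andbT.
  by apply/ltW; exact: HN.
have h3 : \forall x \ae p, forall k, I x -> (`|f_ k x| <= (EFin \o cst B) x)%E.
  apply: aeW => x k Ix; rewrite /f_ patchE; case: ifP => _ /=.
    by rewrite lee_fin fB // inE.
  by rewrite normr0 lee_fin (le_trans _ (fB x _)) // inE.
have [_ _ cv] := dominated_convergence mI h1 mf h2 iB h3.
apply: cvg_unique cv _ => //.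
rewrite (_ : [sequence _]_n = (fun k => (- mp_primitive n (e k))%:E)); last first.
  by apply/funext => k; exact: Ef.
apply: cvg_EFin; first by near=> k.
have -> : 0 = - mp_primitive n (0 : R).
  by rewrite /mp_primitive sqrtr0 mul0r !mulr0 oppr0.
apply: cvgN; apply: (@cvg_comp _ _ _ e _ _ (nbhs (0 : R))).
  exact: cvg_harmonic.
exact: continuous_mp_primitive.
Unshelve. all: by end_near. Qed.

Lemma mp_moment_rec n :
  n.+2%:R * moment p n.+1 = (4 * n + 2)%:R * moment p n.
Proof.
have H : \int[p]_(x in I) mp_factor n x = 0 by rewrite /Rintegral mp_factor_integral.
apply/esym/eqP; rewrite -subr_eq0 !mp_momentE -!RintegralZl //.
rewrite -RintegralB //.
- by apply/eqP; exact: H.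
- exact: (integrableZl mI _ (integrableX n)).
- exact: (integrableZl mI _ (integrableX n.+1)).
Qed.

End MarchenkoPastur.

(** Weighting the convolution T by i + 1 gives a sum S to which the recursion for [m] applies
    termwise: (i + 2) m_(i+1) = 4 (i + 1) m_i - 2 m_i. The symmetry between i and n - i gives 2 S_n
    = (n + 2) T_n, and together these show that T_n obeys the recursion of m_(n+1). *)
Lemma catalan_convolution (K : numFieldType) (m : fps K) : m 0%N = 1 ->
  (forall n, n.+2%:R * m n.+1 = (4 * n + 2)%:R * m n) ->
  m = 1 + fpsX K * (m * m).
Proof.
move=> m0 mS; pose T n := (m * m) n.
pose S n := \sum_(i < n.+1) i.+1%:R * (m i * m (n - i)%N).
have SE n : 2 * S n = n.+2%:R * T n.
  have S' : S n = \sum_(i < n.+1) (n - i).+1%:R * (m i * m (n - i)%N).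
    rewrite /S (reindex_inj rev_ord_inj); apply: eq_bigr => i _ /=.
    by rewrite subSS subKn 1?[m i * _]mulrC // -ltnS.
  rewrite mulr_natl mulr2n {2}S' -big_split /T fpsM mulr_sumr /=.
  apply: eq_bigr => i _; rewrite -mulrDl -natrD; congr (_%:R * _).
  by have := ltn_ord i; lia.
have SS n : S n.+1 = m n.+1 + (4 * S n - 2 * T n).
  rewrite {1}/S big_ord_recl m0 !mul1r subn0; congr (_ + _).
  rewrite /T fpsM /S !mulr_sumr -sumrB; apply: eq_bigr => i _ /=.
  rewrite subSS mulrA mS natrD natrM -natr1; ring.
have TE n : T n = m n.+1.
  elim: n => [|n IH].
    apply: (@mulfI _ 2%:R); rewrite ?pnatr_eq0 // mS /T fpsM big_ord1 m0.
    by rewrite !mulr1.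
  apply: (@mulfI _ n.+3%:R); rewrite ?pnatr_eq0 // mS -SE SS IH.
  have E : S n = n.+2%:R * m n.+1 / 2 by rewrite -IH -SE mulrC mulKf ?pnatr_eq0.
  by rewrite E natrD natrM -[n.+2%:R]natr1 -[n.+1%:R]natr1; field.
apply/funext => -[|n]; first by rewrite fpsD fpsXM /= addr0.
by rewrite fpsD fpsXM /= add0r -/(T n) TE.
Qed.

(** * From measures and words to identities between real series *)

Section Moments.
Variable R : realType.
Implicit Types s : borel_probability R.

Lemma moment0 s : moment s 0 = 1.
Proof.
rewrite /moment /Rintegral.
under eq_integral do rewrite expr0.
by rewrite integral_cst //= mul1e probability_setT.
Qed.

Lemma MserE (K : nzRingType) (m : fps K) : m 0%N = 1 -> Mser m = m - 1 :> fps K.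
Proof.
move=> m0; apply/funext => -[|n]; rewrite fpsD fpsN fps1 /= ?m0 ?subrr //.
by rewrite subr0.
Qed.

Lemma ser_add1_Mser (K : nzRingType) (m : fps K) : m 0%N = 1 ->
  ser_add (@ser_one K) (Mser m) = m.
Proof.
move=> m0; apply/funext => -[|n]; rewrite /ser_add /ser_one /Mser /= ?m0 ?addr0 //.
by rewrite add0r.
Qed.

Lemma is_R_serE (K : nzRingType) (m r : fps K) : m 0%N = 1 ->
  is_R_ser m r <-> r 0%N = 0 /\ fps_comp r (fpsX K * m) = m - 1.
Proof. by move=> m0; rewrite /is_R_ser ser_add1_Mser // MserE // -fpsXME. Qed.

Lemma R_serE (K : nzRingType) (m r : nat -> K) : is_R_ser m r -> R_ser m = r.
Proof.
move=> mr; have [r' [_ U]] := R_ser_ex m.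
by rewrite -(U _ mr) (U _ (R_serP m)).
Qed.

Lemma eta_serE (K : nzRingType) (m e : nat -> K) : is_eta_ser m e -> eta_ser m = e.
Proof.
move=> me; have [e' [_ U]] := eta_ser_ex m.
by rewrite -(U _ me) (U _ (eta_serP m)).
Qed.

Lemma fps_compB1 (K : comNzRingType) (f g : fps K) : g 0%N = 0 ->
  fps_comp (f - 1) g = fps_comp f g - 1.
Proof.
move=> g0; rewrite fps_compD.
have -> : - 1 = fpsC (- 1) :> fps K.
  by apply/funext => -[|n]; rewrite fpsN fps1 ?oppr0.
by rewrite fps_compC.
Qed.

Lemma fps_comp_R (K : comNzRingType) (f m x y : fps K) : m 0%N = 1 ->
  fps_comp f (fpsX K * m) = m - 1 -> y - 1 = fps_comp f (fpsX K * x * y) ->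
  fps_comp (m - 1) (fpsX K * x) = y - 1.
Proof.
move=> m0 fm fy; have x0 : (fpsX K * x) 0%N = 0 by rewrite fpsM0 fpsX0 mul0r.
have Xm0 : (fpsX K * m) 0%N = 0 by rewrite fpsM0 fpsX0 mul0r.
apply: (@fps_comp_fixpoint_unique _ f x); last by rewrite [1 + _]addrC subrK.
rewrite -{1}fm fps_compA // fps_compXM //; congr fps_comp; congr (_ * _).
by rewrite fps_compB1 // addrC subrK.
Qed.

Definition map_fps (K L : Type) (g : K -> L) (f : fps K) : fps L := fun n => g (f n).

Section MapFps.
Variables (K L : nzRingType) (g : {rmorphism K -> L}).

Lemma map_fpsM (f h : fps K) : map_fps g (f * h) = map_fps g f * map_fps g h.
Proof.
apply/funext => n; rewrite /map_fps !fpsM rmorph_sum; apply: eq_bigr => i _.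
exact: rmorphM.
Qed.

Lemma map_fpsD (f h : fps K) : map_fps g (f + h) = map_fps g f + map_fps g h.
Proof. by apply/funext => n; rewrite /map_fps !fpsD rmorphD. Qed.

Lemma map_fps1 : map_fps g 1 = 1.
Proof. by apply/funext => n; rewrite /map_fps !fps1 rmorph_nat. Qed.

Lemma map_fpsX : map_fps g (fpsX K) = fpsX L.
Proof. by apply/funext => n; rewrite /map_fps /fpsX rmorph_nat. Qed.

Lemma map_fps_exp (f : fps K) k : map_fps g (f ^+ k) = map_fps g f ^+ k.
Proof. by elim: k => [|k IH]; rewrite ?map_fps1 // !exprS map_fpsM IH. Qed.

Lemma map_fps_comp (f h : fps K) :
  map_fps g (fps_comp f h) = fps_comp (map_fps g f) (map_fps g h).
Proof.
apply/funext => n; rewrite /map_fps /fps_comp /ser_comp rmorph_sum.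
by apply: eq_bigr => k _; rewrite rmorphM !ser_expE -map_fps_exp.
Qed.

End MapFps.

Local Notation rc := (map_fps (real_complex R)).

(** Words and algebras have coefficients in [R[i]], measures have real moments; identities are
    obtained over [R[i]] and pulled back here. *)
Lemma map_real_complex_inj : injective rc.
Proof. by move=> f h fh; apply/funext => n; have := congr1 (@^~ n) fh => -[]. Qed.

Lemma boxtimes_Marchenko_Pastur s Pi1 rho : is_Marchenko_Pastur Pi1 ->
  is_boxtimes s Pi1 rho -> R_transform rho = (moment s : fps R) - 1.
Proof.
move=> MP [_ _ _ [A [phi [a [b]]]]] [[phi1 _] [_ ma] [_ mb] free mab].
have aE : moments phi a = rc (moment s) by apply/funext => n; exact: ma.
have bE : moments phi b = rc (moment Pi1) by apply/funext => n; exact: mb.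
have abE : moments phi (a * b) = rc (moment rho) by apply/funext => n; exact: mab.
have cat : moments phi b = 1 + fpsX _ * (moments phi b * moments phi b).
  rewrite bE -map_fpsM -(map_fpsX (real_complex R)) -map_fpsM.
  rewrite -(map_fps1 (real_complex R)) -map_fpsD; congr map_fps.
  by apply: catalan_convolution; [exact: moment0|exact: mp_moment_rec].
(* The solution of c = psi_a(z c) turns out to be the moment series of [rho]. Its equation then
   reads M_s(z (1 + M_rho)) = M_rho, which characterises the R-transform of [rho]. *)
have [c cE] := fps_comp_fixpoint_exists (moments phi a).
have abc := free_product_moments phi1 free cat cE.
rewrite -abc abE aE -(map_fpsX (real_complex R)) -map_fpsM -map_fps_comp in cE.
have {}cE := map_real_complex_inj cE.
apply: R_serE; apply/is_R_serE; first exact: moment0.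
split; first by rewrite fpsD fpsN fps1 moment0 subrr.
by rewrite fps_compB1 -?cE // fpsM0 fpsX0 mul0r.
Qed.

(** In the product defining the eta-series, cutting an alternating word at an odd place leaves a
    left factor with zero coefficient. Cuts at even places give exactly the one-variable equation
    for the moments of [s]. *)
Lemma eta_diagonal_alt_word (mu : word -> R[i]) b s : eta_diagonal mu ->
  is_distribution_word mu (if b then word_ZsZ else word_ZZs) s ->
  (fun m => eta_nser mu (alt_word b m.*2)) = rc (eta_transform s).
Proof.
move=> diag [_ ms]; set e := (fun m => _).
have odd0 k : odd k -> eta_nser mu (alt_word b k) = 0.
  move=> ok; apply: diag => n _.
  have [F T] := (word_pow_alt_word false n, word_pow_alt_word true n).
  split=> /(congr1 size); rewrite (F, T) !size_alt_word => E;
  by rewrite E odd_double in ok.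
have Me k : nser_add (@nser_one _) (Mnser mu) (alt_word b k.*2) = rc (moment s) k.
  have := ms k; rewrite word_pow_alt_word /nser_add /nser_one.
  case: k => [|k] /= E; first by rewrite addr0 /map_fps moment0.
  by rewrite add0r E.
have eP : is_eta_ser (rc (moment s)) e.
  rewrite /is_eta_ser ser_add1_Mser ?MserE; try by rewrite /map_fps moment0.
  apply/funext => n.
  have := congr1 (@^~ (alt_word b n.*2)) (eta_nserP mu).
  rewrite /nser_mul size_alt_word => E.
  transitivity (Mnser mu (alt_word b n.*2)); last first.
    have := Me n; rewrite /nser_add fpsD fpsN => <-.
    by case: (n) => [|k] /=; rewrite /nser_one /= ?addr0 ?subrr // add0r subr0.
  rewrite -E /ser_mul -(sum_even_odd (fun i => e i * rc (moment s) (n - i)%N)).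
  apply: eq_bigr => i _; have := ltn_ord i; rewrite ltnS => il.
  rewrite take_alt_word // drop_alt_word.
  case: ifP => oi; first by rewrite odd0 ?mul0r.
  have iE : i = i./2.*2 :> nat by rewrite -[LHS]odd_double_half oi.
  by rewrite addbF iE -doubleB Me /e doubleK.
have eP' : is_eta_ser (rc (moment s)) (rc (eta_transform s)).
  have := eta_serP (moment s); rewrite /is_eta_ser.
  rewrite !ser_add1_Mser ?MserE; try by rewrite /map_fps moment0.
  move=> E; transitivity (rc ((moment s : fps R) - 1)).
    by rewrite -[in RHS]E; exact/esym/map_fpsM.
  by apply/funext => n; rewrite /map_fps !fpsD !fpsN !fps1 rmorphB rmorph_nat.
by rewrite -(eta_serE eP) (eta_serE eP').
Qed.

Lemma eta_transform0 s : eta_transform s 0%N = 0.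
Proof.
have := congr1 (@^~ 0%N) (eta_serP (moment s)).
by rewrite ser_add1_Mser ?moment0 // /ser_mul big_ord1 moment0 mulr1.
Qed.

(** R_nu = eta_mu is carried by alternating words of even length, with the eta-coefficients of [s1]
    when the first letter is Z and those of [s2] when it is its adjoint; this is the situation of
    [alt_moments_fixpoint]. *)
Lemma Psi_fixpoint s1 s2 nu (tau : bool -> borel_probability R) :
  is_Psi s1 s2 nu ->
  (forall b : bool,
     is_distribution_word nu (if b then word_ZsZ else word_ZZs) (tau b)) ->
  forall b : bool, (moment (tau b) : fps R) - 1 =
    fps_comp (eta_transform (if b then s2 else s1))
      (fpsX R * (moment (tau false) : fps R) * (moment (tau true) : fps R)).
Proof.
move=> [_ _ _ [mu [_ diag m1 m2 rE]]] dtau b.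
pose s b := if b then s2 else s1.
have ms c : is_distribution_word mu (if c then word_ZsZ else word_ZZs) (s c).
  by case: c.
pose alpha c : fps R[i] := rc (eta_transform (s c)).
have alphaE c := eta_diagonal_alt_word diag (ms c).
have alpha0 c : alpha c 0%N = 0 by rewrite /alpha /map_fps eta_transform0.
have r_alt c m : (0 < m)%N -> R_nser nu (alt_word c m.*2) = alpha c m.
  by move=> _; rewrite rE -[LHS]/((fun m => eta_nser mu (alt_word c m.*2)) m) alphaE.
have r_out w : (forall c m, (0 < m)%N -> w <> alt_word c m.*2) -> R_nser nu w = 0.
  move=> wP; rewrite rE; apply: diag => n n0.
  have [F T] := (word_pow_alt_word false n, word_pow_alt_word true n).
  by rewrite F T; split; apply: wP.
have PE c : alt_moments (R_nser nu) c = rc (moment (tau c)).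
  apply/funext => k; have [_ /(_ k)] := dtau c.
  rewrite word_pow_alt_word /alt_moments; case: k => [|k] E.
    by rewrite /map_fps moment0; exact: word_sum_nil.
  by rewrite (word_sumE (R_nserP nu)) // E.
have := alt_moments_fixpoint alpha0 r_alt r_out b; rewrite !PE => E.
apply: map_real_complex_inj.
rewrite map_fps_comp !map_fpsM map_fpsX.
have -> : rc ((moment (tau b) : fps R) - 1) = rc (moment (tau b)) - 1.
  by apply/funext => n; rewrite /map_fps !fpsD !fpsN !fps1 rmorphB rmorph_nat.
by rewrite E [1 + _]addrC addrK.
Qed.

End Moments.

Theorem proposition6p8 (R : realType) (sigma : borel_probability R) (t : R)
    (sigma_t beta Pi1 tau1 tau2 : borel_probability R) (nu : word -> complex R) :
  Pc_plus sigma ->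
  0 < t ->
  is_uplus_power sigma t sigma_t ->
  is_Psi sigma_t sigma nu ->
  is_distribution_word nu word_ZZs tau1 ->
  is_distribution_word nu word_ZsZ tau2 ->
  is_Bercovici_Pata sigma beta ->
  is_Marchenko_Pastur Pi1 ->
  (forall rho1 : borel_probability R,
     is_boxtimes beta Pi1 rho1 -> is_boxplus_power rho1 t tau1) /\
  (forall beta_t rho2 : borel_probability R,
     is_boxplus_power beta t beta_t -> is_boxtimes beta_t Pi1 rho2 ->
     is_boxplus_power rho2 t^-1 tau2).
Proof.
move=> _ t0 [_ _ etat] psi d1 d2 [_ _ Rbeta] MP.
pose e : fps R := eta_transform sigma.
pose P : fps R := moment tau1; pose Q : fps R := moment tau2.
have scaleE (c : R) (f : nat -> R) : ser_scale c f = fpsC c * (f : fps R).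
  by apply/funext => n; rewrite fpsCM.
have fix_PQ := Psi_fixpoint psi (tau := fun b => if b then tau2 else tau1)
  (fun b => if b as b return is_distribution_word nu
     (if b then word_ZsZ else word_ZZs) (if b then tau2 else tau1) then d2 else d1).
have QE : Q - 1 = fps_comp e (fpsX R * P * Q) := fix_PQ true.
have PE : P - 1 = fpsC t * (Q - 1).
  have := fix_PQ false; rewrite etat scaleE fps_compCM => ->.
  by rewrite QE.
have betaE : fps_comp e (fpsX R * (moment beta : fps R)) = (moment beta : fps R) - 1.
  have := R_serP (moment beta); rewrite -/(R_transform beta) Rbeta.
  by case/(is_R_serE _ (moment0 beta)).
have tV : fpsC t^-1 * fpsC t = 1 :> fps R.
  apply/funext => n; rewrite fpsCM fps1 /fpsC.
  by case: eqP; rewrite ?mulr0 // mulVf ?gt_eqF.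
split=> [rho1 rho1P|beta_t rho2 [_ _ Rbt] rho2P].
  have [_ _ [rhoPc _] _] := rho1P; split=> //; first by case: d1 => -[].
  rewrite (boxtimes_Marchenko_Pastur MP rho1P) scaleE; apply: R_serE.
  apply/is_R_serE; first exact: moment0.
  split; first by rewrite fpsM0 fpsD fpsN moment0 fps1 subrr mulr0.
  (* The equation defining the R-transform of [tau1] holds for t M_beta: t M_beta(z P) = t (Q - 1) =
     P - 1. *)
  rewrite fps_compCM (fps_comp_R (moment0 beta) betaE QE).
  exact/esym.
have btE : fps_comp (fpsC t * e) (fpsX R * (moment beta_t : fps R)) =
    (moment beta_t : fps R) - 1.
  have := R_serP (moment beta_t).
  rewrite -/(R_transform beta_t) Rbt Rbeta scaleE.
  by case/(is_R_serE _ (moment0 beta_t)).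
(* [P] and [Q] exchange roles: t e is the R-transform of [beta_t], and P - 1 = t (Q - 1) is its
   value at z Q P. *)
have PE' : P - 1 = fps_comp (fpsC t * e) (fpsX R * Q * P).
  by rewrite fps_compCM PE QE mulrAC.
have [_ _ [rhoPc _] _] := rho2P; split=> //; first by case: d2 => -[].
rewrite (boxtimes_Marchenko_Pastur MP rho2P) scaleE; apply: R_serE.
apply/is_R_serE; first exact: moment0.
split; first by rewrite fpsM0 fpsD fpsN moment0 fps1 subrr mulr0.
rewrite fps_compCM (fps_comp_R (moment0 beta_t) btE PE').
by rewrite PE mulrA tV mul1r.
Qed.
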